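(* Let $1\le p\le\infty$, let $X$ be a pointed metric space, $E$ a Banach space and $T:X\to E$ a Lipschitz operator. The following properties are equivalent: (1) $T$ is strictly Lipschitz $p$-nuclear. (2) There exist a Banach space $G$, a strictly Lipschitz $p$-summing operator $R:X\to G$ and a Cohen strongly $p$-summing linear operator $S:G\to E$ such that $T=S\circ R$.
   Context: Banach spaces are real. A pointed metric space $X$ has a distinguished point $0$. A Lipschitz operator $T:X\to E$ is a Lipschitz map with $T(0)=0$. $X^{\#}$ is the Banach space of Lipschitz functions $f:X\to\mathbb R$ with $f(0)=0$, normed by the Lipschitz constant. For $x,y\in X$, $\delta_{(x,y)}\in (X^{\#})^*$ is $\delta_{(x,y)}(f)=f(x)-f(y)$; $\mathcal F(X)$ is the closed linear span of all $\delta_{(x,y)}$ in $(X^{\#})^*$, and $\mathcal F(X)^*=X^{\#}$ isometrically. $1/p+1/p^*=1$. For a finite sequence in a Banach space $E$: $\|(e_i)\|_{l_p^n(E)}=(\sum_i\|e_i\|^p)^{1/p}$ and $\|(e_i)\|_{l_p^{n,w}(E)}=\sup_{e^*\in B_{E^*}}(\sum_i|\langle e_i,e^*\rangle|^p)^{1/p}$ (maxima when $p=\infty$). A bounded linear operator $S:G\to E$ is Cohen strongly $p$-summing if there is $C>0$ with $\sum_{i=1}^n|\langle S(x_i),y_i^*\rangle|\le C\|(x_i)\|_{l_p^n(G)}\|(y_i^* )\|_{l_{p^*}^{n,w}(E^* )}$ for all $n$, $x_i\in G$, $y_i^*\in E^*$. $X\boxtimes E^*$ (Lipschitz tensor product)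 is the span of the functionals $\delta_{(x,y)}\boxtimes e^*: f\mapsto\langle f(x)-f(y),e^*\rangle$ on the space $Lip_0(X;E^{**})$ of Lipschitz maps $X\to E^{**}$ vanishing at $0$. For $u=\sum_{k=1}^l\delta_{(x_k,y_k)}\boxtimes s_k^*\in X\boxtimes E^*$, let $A_u$ be the set of all representations $\sum_{i=1}^n m_i\otimes e_i^*$ ($m_i\in\mathcal F(X)$, $e_i^*\in E^*$) equal to $\sum_{k=1}^l\delta_{(x_k,y_k)}\otimes s_k^*$ in $\mathcal F(X)\otimes E^*$, and put $$d_p^L(u)=\inf_{A_u}\|(m_i)\|_{l_p^{n,w}(\mathcal F(X))}\|(e_i^* )\|_{l_{p^*}^n(E^* )},\qquad w_p^{SL}(u)=\inf_{A_u}\|(m_i)\|_{l_p^{n,w}(\mathcal F(X))}\|(e_i^* )\|_{l_{p^*}^{n,w}(E^* )}.$$ A Lipschitz operator $T:X\to E$ is strictly Lipschitz $p$-summing (resp. strictly Lipschitz $p$-nuclear) if there is $C>0$ such that for all $l$, $x_k,y_k\in X$, $s_k^*\in E^*$ ($1\le k\le l$), with $u=\sum_{k=1}^l\delta_{(x_k,y_k)}\boxtimes s_k^*$, one has $\big|\sum_{k=1}^l\langle T(x_k)-T(y_k),s_k^*\rangle\big|\le C\,d_p^L(u)$ (resp. $\le C\,w_p^{SL}(u)$). *)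

(* Defs.v *)
From HB Require Import structures.
From mathcomp Require Import all_boot all_order all_algebra.
From mathcomp Require Import all_classical all_reals all_analysis.

Set Implicit Arguments.
Unset Strict Implicit.
Unset Printing Implicit Defensive.

Import Order.TTheory GRing.Theory Num.Theory.
Import numFieldNormedType.Exports.

Local Open Scope classical_set_scope.
Local Open Scope ring_scope.

Section Dual.
Context {R : realType} (V : normedModType R).

(* [dual V] is V^*, normed by the operator norm. *)
Definition dual_pred : {pred V -> R} :=
  fun f => `[< scalar f /\ continuous f >].

Lemma dual_predP (f : V -> R) :
  reflect (scalar f /\ continuous f) (f \in dual_pred).
Proof. exact: asboolP. Qed.

Lemma dual_submod_closed : submod_closed dual_pred.
Proof.
split=> [|a f g /dual_predP[lf cf] /dual_predP[lg cg]]; apply/dual_predP.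
  by split=> [k u v /=|x]; [rewrite mulr0 addr0|exact: cst_continuous].
split=> [k u v|x].
  rewrite !fctE /= /GRing.scale/= lf lg !mulrDr addrACA; congr (_ + _ + _ ).
    by rewrite mulrCA.
by apply: cvgD; [apply: cvgMl_tmp; exact: cf|exact: cg].
Qed.

HB.instance Definition _ :=
  GRing.isSubmodClosed.Build R (V -> R) dual_pred dual_submod_closed.

Record dual : Type :=
  Dual { dual_fun :> V -> R ; dual_funP : dual_fun \in dual_pred }.

HB.instance Definition _ := [isSub for dual_fun].
HB.instance Definition _ := [Choice of dual by <:].
HB.instance Definition _ := [SubChoice_isSubZmodule of dual by <:].
HB.instance Definition _ := [SubZmodule_isSubLmodule of dual by <:].

Lemma dual_linear (f : dual) : scalar f.
Proof. by have /dual_predP[] := dual_funP f. Qed.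

HB.instance Definition _ (f : dual) :=
  GRing.isLinear.Build R V R *%R (dual_fun f) (dual_linear f).

Lemma dual_continuous (f : dual) : continuous f.
Proof. by have /dual_predP[] := dual_funP f. Qed.

Definition dual_norm (f : dual) : R :=
  sup [set `|f x| | x in [set x : V | `|x| <= 1]].

Lemma dual_norm_has_sup (f : dual) :
  has_sup [set `|f x| | x in [set x : V | `|x| <= 1]].
Proof.
split; first by exists `|f 0|, 0 => //=; rewrite normr0.
have := @dual_continuous f 0 => /(@continuous_linear_bounded _ _ _ 0 f).
move=> /linear_boundedP/pinfty_ex_gt0[r r0 fr]; exists r => _ [x /= x1 <-].
by rewrite (le_trans (fr x))// ler_piMr// ltW.
Qed.

Lemma dual_norm_le (f : dual) C :
  (forall x, `|x| <= 1 -> `|f x| <= C) -> dual_norm f <= C.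
Proof.
move=> fC; apply: ge_sup; first by case: (dual_norm_has_sup f).
by move=> _ [x /= x1 <-]; exact: fC.
Qed.

Lemma ler_dual_norm1 (f : dual) x : `|x| <= 1 -> `|f x| <= dual_norm f.
Proof.
by move=> x1; apply: (sup_upper_bound (dual_norm_has_sup f)); exists x.
Qed.

Lemma dual_norm_ge0 (f : dual) : 0 <= dual_norm f.
Proof. by rewrite (le_trans _ (@ler_dual_norm1 f 0 _)) ?normr0. Qed.

Lemma ler_dual_norm_apply (f : dual) x : `|f x| <= dual_norm f * `|x|.
Proof.
have [->|x0] := eqVneq x 0; first by rewrite linear0 !normr0 mulr0.
rewrite -ler_pdivrMr ?normr_gt0// mulrC.
have -> : `|x|^-1 * `|f x| = `|f (`|x|^-1 *: x)|.
  by rewrite linearZ normrM gtr0_norm// invr_gt0 normr_gt0.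
apply: ler_dual_norm1.
by rewrite normrZ gtr0_norm ?invr_gt0 ?normr_gt0// mulVf// normr_eq0.
Qed.

Lemma dual_normD (f g : dual) : dual_norm (f + g) <= dual_norm f + dual_norm g.
Proof.
apply: dual_norm_le => x x1; rewrite (le_trans (ler_normD _ _))//.
by rewrite lerD// ler_dual_norm1.
Qed.

Lemma dual_normZ (a : R) (f : dual) : dual_norm (a *: f) = `|a| * dual_norm f.
Proof.
have le_Z b g : dual_norm (b *: g) <= `|b| * dual_norm g.
  apply: dual_norm_le => x x1.
  by rewrite [leLHS]normrM ler_wpM2l// ler_dual_norm1.
apply/eqP; rewrite eq_le le_Z/=.
have [->|a0] := eqVneq a 0; first by rewrite normr0 mul0r dual_norm_ge0.
rewrite -ler_pdivlMl ?normr_gt0// -normfV.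
by rewrite -{1}(scale1r f) -(mulVf a0) -scalerA.
Qed.

Lemma dual_norm0_eq0 (f : dual) : dual_norm f = 0 -> f = 0.
Proof.
move=> f0; apply: val_inj; apply/funext => x /=; apply/eqP.
by rewrite -normr_le0 (le_trans (ler_dual_norm_apply f x))// f0 mul0r.
Qed.

HB.instance Definition _ :=
  Lmodule_isNormed.Build R dual dual_normD dual_normZ dual_norm0_eq0.

End Dual.

Section Lip0.
Context {R : realType} {X : metricType R} (x0 : X) (V : normedModType R).

(* [Lip0 x0 V] is Lip_0(X; V), for X pointed at x0; in particular X^# is
   [Lip0 x0 R] and a Lipschitz operator X -> E is an element of [Lip0 x0 E]. *)
Definition lip0_pred : {pred X -> V} := fun f =>
  `[< f x0 = 0 /\ exists C : R, forall x y, `|f x - f y| <= C * mdist x y >].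

Lemma lip0_predP (f : X -> V) :
  reflect (f x0 = 0 /\ exists C : R, forall x y, `|f x - f y| <= C * mdist x y)
          (f \in lip0_pred).
Proof. exact: asboolP. Qed.

Lemma lip0_submod_closed : submod_closed lip0_pred.
Proof.
split=> [|a f g /lip0_predP[f0 [C fC]] /lip0_predP[g0 [D gD]]];
    apply/lip0_predP.
  by split=> //; exists 0 => x y; rewrite subrr normr0 mul0r.
split; first by rewrite !fctE f0 g0 scaler0 addr0.
exists (`|a| * C + D) => x y; rewrite !fctE opprD addrACA -scalerBr.
rewrite (le_trans (ler_normD _ _))// mulrDl lerD// normrZ -mulrA.
by rewrite ler_wpM2l.
Qed.

HB.instance Definition _ :=
  GRing.isSubmodClosed.Build R (X -> V) lip0_pred lip0_submod_closed.

Record Lip0 : Type :=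
  MkLip0 { lip0_fun :> X -> V ; lip0_funP : lip0_fun \in lip0_pred }.

HB.instance Definition _ := [isSub for lip0_fun].
HB.instance Definition _ := [Choice of Lip0 by <:].
HB.instance Definition _ := [SubChoice_isSubZmodule of Lip0 by <:].
HB.instance Definition _ := [SubZmodule_isSubLmodule of Lip0 by <:].

Lemma lip0_base (f : Lip0) : f x0 = 0.
Proof. by have /lip0_predP[] := lip0_funP f. Qed.

(* The pairs x = y only contribute 0 / 0 = 0, so that the set is never empty,
   even when X is a single point. *)
Definition lip_norm (f : Lip0) : R :=
  sup [set `|f xy.1 - f xy.2| / mdist xy.1 xy.2 | xy in [set: X * X]].

Lemma lip_norm_has_sup (f : Lip0) :
  has_sup [set `|f xy.1 - f xy.2| / mdist xy.1 xy.2 | xy in [set: X * X]].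
Proof.
split; first by eexists; exists (x0, x0).
have /lip0_predP[_ [C fC]] := lip0_funP f; exists `|C| => _ [[x y] _ <-] /=.
have [->|xy] := eqVneq x y; first by rewrite subrr normr0 mul0r.
rewrite ler_pdivrMr ?mdist_gt0// (le_trans (fC _ _))//.
by rewrite ler_wpM2r ?ler_norm ?mdist_ge0.
Qed.

Lemma ler_lip_norm (f : Lip0) x y : `|f x - f y| <= lip_norm f * mdist x y.
Proof.
have [->|xy] := eqVneq x y; first by rewrite subrr normr0 mdistxx mulr0.
rewrite -ler_pdivrMr ?mdist_gt0//.
by apply: (sup_upper_bound (lip_norm_has_sup f)); exists (x, y).
Qed.

Lemma lip_norm_ge0 (f : Lip0) : 0 <= lip_norm f.
Proof.
apply: (le_trans (y := `|f x0 - f x0| / mdist x0 x0)).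
  by rewrite subrr normr0 mul0r.
by apply: (sup_upper_bound (lip_norm_has_sup f)); exists (x0, x0).
Qed.

Lemma lip_norm_le (f : Lip0) C : 0 <= C ->
  (forall x y, `|f x - f y| <= C * mdist x y) -> lip_norm f <= C.
Proof.
move=> C0 fC; apply: ge_sup; first by case: (lip_norm_has_sup f).
move=> _ [[x y] _ <-] /=.
have [->|xy] := eqVneq x y; first by rewrite subrr normr0 mul0r.
by rewrite ler_pdivrMr ?mdist_gt0.
Qed.

Lemma lip_normD (f g : Lip0) : lip_norm (f + g) <= lip_norm f + lip_norm g.
Proof.
apply: lip_norm_le => [|x y]; first by rewrite addr_ge0 ?lip_norm_ge0.
rewrite [X in `|X|](_ : _ = (f x - f y) + (g x - g y)); last first.
  by rewrite addrACA -opprD.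
by rewrite (le_trans (ler_normD _ _))// mulrDl lerD ?ler_lip_norm.
Qed.

Lemma lip_normZ (a : R) (f : Lip0) : lip_norm (a *: f) = `|a| * lip_norm f.
Proof.
have le_Z b g : lip_norm (b *: g) <= `|b| * lip_norm g.
  apply: lip_norm_le => [|x y]; first by rewrite mulr_ge0 ?lip_norm_ge0.
  rewrite [X in `|X|](_ : _ = b *: (g x - g y)); last by rewrite scalerBr.
  by rewrite normrZ -mulrA ler_wpM2l ?ler_lip_norm.
apply/eqP; rewrite eq_le le_Z/=.
have [->|a0] := eqVneq a 0; first by rewrite normr0 mul0r lip_norm_ge0.
rewrite -ler_pdivlMl ?normr_gt0// -normfV.
by rewrite -{1}(scale1r f) -(mulVf a0) -scalerA.
Qed.

Lemma lip_norm0_eq0 (f : Lip0) : lip_norm f = 0 -> f = 0.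
Proof.
move=> f0; apply: val_inj; apply/funext => x /=; apply/eqP.
rewrite -normr_le0 -[f x]subr0 -(lip0_base f).
by rewrite (le_trans (ler_lip_norm f x x0))// f0 mul0r.
Qed.

HB.instance Definition _ :=
  Lmodule_isNormed.Build R Lip0 lip_normD lip_normZ lip_norm0_eq0.

End Lip0.

Section LipschitzFree.
Context {R : realType} {X : metricType R} (x0 : X).

Definition delta_fun (x y : X) : Lip0 x0 R -> R := fun f => f x - f y.

Lemma delta_fun_dual x y : delta_fun x y \in dual_pred (V := Lip0 x0 R).
Proof.
have ld : scalar (delta_fun x y).
  by move=> a f g; rewrite /delta_fun /= mulrBr addrACA -opprD.
pose L : {scalar Lip0 x0 R} := HB.pack (delta_fun x y)
  (GRing.isLinear.Build R (Lip0 x0 R) R *%R (delta_fun x y) ld).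
apply/dual_predP; split=> //.
apply: (@bounded_linear_continuous R (Lip0 x0 R) R L).
apply/linear_boundedP; exists (mdist x y); split; first exact: num_real.
move=> r xyr f; rewrite (le_trans (ler_lip_norm f x y))// mulrC.
by rewrite ler_wpM2r ?lip_norm_ge0// ltW.
Qed.

Definition delta (x y : X) : dual (Lip0 x0 R) := Dual (delta_fun_dual x y).

Definition delta_span : set (dual (Lip0 x0 R)) :=
  [set m | exists n (a : 'I_n -> R) (x y : 'I_n -> X),
     m = \sum_(i < n) a i *: delta (x i) (y i)].

(* [lipfree x0] is F(X), with the norm induced by (X^#)^*. *)
Definition lipfree_pred : {pred dual (Lip0 x0 R)} :=
  fun m => `[< closure delta_span m >].

Lemma delta_span_lin (a : R) (m1 m2 : dual (Lip0 x0 R)) :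
  delta_span m1 -> delta_span m2 -> delta_span (a *: m1 + m2).
Proof.
move=> [n1 [a1 [u1 [v1 ->]]]] [n2 [a2 [u2 [v2 ->]]]].
pose sel T (g1 : 'I_n1 -> T) (g2 : 'I_n2 -> T) (i : 'I_(n1 + n2)) :=
  match fintype.split i with inl j => g1 j | inr j => g2 j end.
exists (n1 + n2)%N, (sel R (fun j => a * a1 j) a2), (sel X u1 u2), (sel X v1 v2).
rewrite big_split_ord /= scaler_sumr; congr (_ + _); apply: eq_bigr => i _.
  by rewrite /sel (unsplitK (inl i)) scalerA.
by rewrite /sel (unsplitK (inr i)).
Qed.

Lemma lipfree_predP (m : dual (Lip0 x0 R)) :
  reflect (forall e, 0 < e -> exists2 m', delta_span m' & `|m - m'| < e)
          (m \in lipfree_pred).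
Proof.
apply: (iffP (asboolP (closure delta_span m))) => [cm e e0|me].
  have [m' [sm me]] := cm _ (nbhsx_ballx m e e0); exists m' => //; exact: me.
move=> B /nbhs_normP[e e0 eB].
by have [m' ? ?] := me _ e0; exists m'; split=> //; exact: eB.
Qed.

Lemma lipfree_submod_closed : submod_closed lipfree_pred.
Proof.
split=> [|a m1 m2 /lipfree_predP c1 /lipfree_predP c2]; apply/lipfree_predP.
  move=> e e0; exists 0; last by rewrite subrr normr0.
  by exists 0%N, (fun=> 0), (fun=> x0), (fun=> x0); rewrite big_ord0.
move=> e e0; have a1 : 0 < `|a| + 1 by rewrite ltr_wpDl.
have e2 : 0 < e / 2 by rewrite divr_gt0.
have [m1' s1 d1] := c1 _ (divr_gt0 e2 a1).
have [m2' s2 d2] := c2 _ e2.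
exists (a *: m1' + m2'); first exact: delta_span_lin.
rewrite opprD addrACA -scalerBr (le_lt_trans (ler_normD _ _))//.
rewrite [ltRHS]splitr ler_ltD//.
rewrite normrZ (le_trans (ler_wpM2l (normr_ge0 a) (ltW d1)))//.
by rewrite mulrCA ler_piMr ?(ltW e2)// ler_pdivrMr// mul1r lerDl.
Qed.

HB.instance Definition _ := GRing.isSubmodClosed.Build R (dual (Lip0 x0 R))
  lipfree_pred lipfree_submod_closed.

Record lipfree : Type := MkLipfree {
  lipfree_val :> dual (Lip0 x0 R) ; lipfree_valP : lipfree_val \in lipfree_pred }.

HB.instance Definition _ := [isSub for lipfree_val].
HB.instance Definition _ := [Choice of lipfree by <:].
HB.instance Definition _ := [SubChoice_isSubZmodule of lipfree by <:].
HB.instance Definition _ := [SubZmodule_isSubLmodule of lipfree by <:].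

Definition lipfree_norm (m : lipfree) : R := `|lipfree_val m|.

Lemma lipfree_normD (m1 m2 : lipfree) :
  lipfree_norm (m1 + m2) <= lipfree_norm m1 + lipfree_norm m2.
Proof. exact: ler_normD. Qed.

Lemma lipfree_normZ (a : R) (m : lipfree) :
  lipfree_norm (a *: m) = `|a| * lipfree_norm m.
Proof. exact: normrZ. Qed.

Lemma lipfree_norm0_eq0 (m : lipfree) : lipfree_norm m = 0 -> m = 0.
Proof. by move=> /normr0_eq0 m0; exact: val_inj. Qed.

HB.instance Definition _ := Lmodule_isNormed.Build R lipfree
  lipfree_normD lipfree_normZ lipfree_norm0_eq0.

Lemma delta_lipfree (x y : X) : delta x y \in lipfree_pred.
Proof.
apply/lipfree_predP => e e0; exists (delta x y); last by rewrite subrr normr0.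
exists 1%N, (fun=> 1), (fun=> x), (fun=> y).
by rewrite big_ord1 scale1r.
Qed.

Definition ldelta (x y : X) : lipfree := MkLipfree (delta_lipfree x y).

End LipschitzFree.

Section LpNorms.
Context {R : realType}.

(* Only used for 1 <= p; the value at -oo is a dummy. *)
Definition lp_norm (p : \bar R) (n : nat) (a : 'I_n -> R) : R :=
  match p with
  | r%:E => (\sum_(i < n) `|a i| `^ r) `^ r^-1
  | +oo%E => \big[Num.max/0]_(i < n) `|a i|
  | -oo%E => 0
  end.

Definition lp_strong (p : \bar R) (V : normedModType R) (n : nat)
  (e : 'I_n -> V) : R := lp_norm p (fun i => `|e i|).

(* The supremum is over a nonempty set, and a bounded one when 1 <= p
   (by [lp_strong p e]). *)
Definition lp_weak (p : \bar R) (V : normedModType R) (n : nat)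
  (e : 'I_n -> V) : R :=
  sup [set lp_norm p (fun i => phi (e i)) | phi in [set phi : dual V | `|phi| <= 1]].

End LpNorms.

Section LipTensor.
Context {R : realType} {X : metricType R} (x0 : X) (E : normedModType R).

(* The algebraic tensor product M (x) N is realized, as is usual in Banach space
   theory, as a space of functionals on the bilinear forms on M x N. *)
Definition tens (m : lipfree x0) (s : dual E) :
    {bilinear lipfree x0 -> dual E -> R | *%R & *%R} -> R :=
  fun B => B m s.

(* The box tensor of delta_(x,y) and s; finite sums of these make up the
   Lipschitz tensor product, scalars being absorbed by s. *)
Definition lip_tens (x y : X) (s : dual E) : Lip0 x0 (dual (dual E)) -> R :=
  fun f => (f x - f y) s.

(* (m_i), (e_i) is an element of A_u. By [representsP] below, the choice of the
   representation of u is immaterial. *)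
Definition represents (u : Lip0 x0 (dual (dual E)) -> R) (n : nat)
    (m : 'I_n -> lipfree x0) (e : 'I_n -> dual E) : Prop :=
  exists l (x y : 'I_l -> X) (s : 'I_l -> dual E),
    u = \sum_(k < l) lip_tens (x k) (y k) (s k) /\
    \sum_(i < n) tens (m i) (e i)
      = \sum_(k < l) tens (ldelta x0 (x k) (y k)) (s k).

(* In [dL] and [wSL] the infimum is over a set of nonnegative reals, which is
   nonempty when u is in the Lipschitz tensor product. *)
Definition dL (p : \bar R) (u : Lip0 x0 (dual (dual E)) -> R) : R :=
  inf [set r | exists n (m : 'I_n -> lipfree x0) (e : 'I_n -> dual E),
    represents u m e /\ r = lp_weak p m * lp_strong (hoelder_conjugate p) e].

Definition wSL (p : \bar R) (u : Lip0 x0 (dual (dual E)) -> R) : R :=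
  inf [set r | exists n (m : 'I_n -> lipfree x0) (e : 'I_n -> dual E),
    represents u m e /\ r = lp_weak p m * lp_weak (hoelder_conjugate p) e].

Lemma tens_separated (t : seq (lipfree x0 * dual E)) :
  (forall (g : Lip0 x0 R) (v : E),
     \sum_(q <- t) (q.1 : dual (Lip0 x0 R)) g * q.2 v = 0) ->
  \sum_(q <- t) tens q.1 q.2 = 0.
Proof.
have [n] := ubnP (size t); elim: n t => // n IH [|[m s] t] /=.
  by rewrite big_nil.
rewrite ltnS => tn H; rewrite big_cons /=.
have [s0|s0] := eqVneq s 0.
  have -> : tens m s = 0 by apply/funext => B; rewrite /tens s0 linear0r.
  rewrite add0r; apply: IH => // g v; rewrite -[RHS](H g v) big_cons /= s0.
  by rewrite mulr0 add0r.
have [v0 sv0] : exists v0, s v0 != 0.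
  apply/not_existsP => s'0; move/eqP: s0; apply; apply: val_inj.
  by apply/funext => v /=; have /negP := s'0 v; rewrite negbK => /eqP.
pose c (r : lipfree x0 * dual E) := r.2 v0 / s v0.
have mE (g : Lip0 x0 R) : m g = - \sum_(r <- t) c r * r.1 g.
  have /eqP := H g v0; rewrite big_cons /= addr_eq0 => /eqP mv0.
  apply: (mulIf sv0); rewrite mv0 mulNr mulr_suml; congr (- _).
  apply: eq_bigr => r _.
  by rewrite /c mulrAC divfK// mulrC.
have {}mE : m = - \sum_(r <- t) c r *: r.1.
  apply: val_inj; apply: val_inj; apply/funext => g /=; rewrite mE.
  pose ev (m' : lipfree x0) := m' g.
  have ev0 : ev 0 = 0 by [].
  have evD : {morph ev : u w / u + w >-> u + w} by [].
  by rewrite -[RHS]/(- ev _) (big_morph ev evD ev0).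
have := IH [seq (r.1, r.2 - c r *: s) | r <- t].
rewrite size_map big_map => /(_ tn) {}IH.
rewrite -[RHS]IH => [|g v]; last first.
  rewrite big_map /= -[RHS](H g v) big_cons /= mE.
  pose ev (m' : lipfree x0) := m' g.
  have ev0 : ev 0 = 0 by [].
  have evD : {morph ev : u w / u + w >-> u + w} by [].
  rewrite -[X in _ = X * _ + _]/(- ev _) (big_morph ev evD ev0).
  rewrite mulNr mulr_suml addrC -sumrB; apply: eq_bigr => r _.
  transitivity (r.1 g * (r.2 v - c r * s v)); first by [].
  by rewrite mulrBr mulrCA mulrA.
apply/funext => B; rewrite !fctE !fct_sumE /tens /=.
rewrite mE linearNl linear_sumlz -sumrN -big_split /=; apply: eq_bigr => r _.
by rewrite linearZl_LR linearBr linearZr_LR addrC.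
Qed.

Lemma scale_eval_lip0 (g : Lip0 x0 R) (v : E) :
  exists f : Lip0 x0 (dual (dual E)), forall x (s : dual E), f x s = g x * s v.
Proof.
pose ev (s : dual E) := s v.
have lev : scalar ev by [].
pose L : {scalar dual E} :=
  HB.pack ev (GRing.isLinear.Build R (dual E) R *%R ev lev).
have evP : ev \in dual_pred (V := dual E).
  apply/dual_predP; split=> //.
  apply: (@bounded_linear_continuous R (dual E) R L).
  apply/linear_boundedP; exists `|v|; split; first exact: num_real.
  move=> r vr s; rewrite (le_trans (ler_dual_norm_apply s v))// mulrC.
  by rewrite ler_wpM2r ?dual_norm_ge0// ltW.
have fP : (fun x => g x *: Dual evP) \in lip0_pred x0 (V := dual (dual E)).
  apply/lip0_predP; split; first by rewrite lip0_base scale0r.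
  exists (lip_norm g * `|Dual evP|) => x y; rewrite -scalerBl normrZ mulrAC.
  by rewrite ler_wpM2r// ler_lip_norm.
by exists (MkLip0 fP).
Qed.

(* The tensor in F(X) (x) E^* attached to an element of the Lipschitz tensor
   product does not depend on its representation. *)
Lemma lip_tens_wd l (x y : 'I_l -> X) (s : 'I_l -> dual E)
    l' (x' y' : 'I_l' -> X) (s' : 'I_l' -> dual E) :
  \sum_(k < l) lip_tens (x k) (y k) (s k)
    = \sum_(k < l') lip_tens (x' k) (y' k) (s' k) ->
  \sum_(k < l) tens (ldelta x0 (x k) (y k)) (s k)
    = \sum_(k < l') tens (ldelta x0 (x' k) (y' k)) (s' k).
Proof.
move=> eq_u.
pose t := [seq (ldelta x0 (x k) (y k), s k) | k <- index_enum 'I_l] ++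
  [seq (ldelta x0 (x' k) (y' k), - s' k) | k <- index_enum 'I_l'].
have tE (U : zmodType) (F : lipfree x0 * dual E -> U) : \sum_(q <- t) F q =
    \sum_(k < l) F (ldelta x0 (x k) (y k), s k) +
    \sum_(k < l') F (ldelta x0 (x' k) (y' k), - s' k).
  by rewrite big_cat !big_map.
have : \sum_(q <- t) tens q.1 q.2 = 0.
  apply: tens_separated => g v; rewrite tE /=.
  have [f fE] := scale_eval_lip0 g v.
  have : (\sum_(k < l) lip_tens (x k) (y k) (s k)) f =
    (\sum_(k < l') lip_tens (x' k) (y' k) (s' k)) f by rewrite eq_u.
  rewrite !fct_sumE /lip_tens => eq_f; apply/eqP; rewrite addr_eq0 -sumrN.
  have bE a b (w : dual E) : (f a - f b) w = delta x0 a b g * w v.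
    by rewrite -[LHS]/(f a w - f b w) !fE -mulrBl.
  have {}eq_f : \sum_(k < l) delta x0 (x k) (y k) g * s k v =
      \sum_(k < l') delta x0 (x' k) (y' k) g * s' k v.
    by under eq_bigr do rewrite -bE; under [RHS]eq_bigr do rewrite -bE.
  apply/eqP; rewrite eq_f; apply: eq_bigr => k _.
  transitivity (- (delta x0 (x' k) (y' k) g * - s' k v)); last by [].
  by rewrite mulrN opprK.
rewrite tE => /eqP; rewrite addr_eq0 -sumrN => /eqP ->.
apply: eq_bigr => k _; apply/funext => B.
by rewrite /tens -[LHS]/(- B _ _) linearNr opprK.
Qed.

Lemma representsP l (x y : 'I_l -> X) (s : 'I_l -> dual E)
    n (m : 'I_n -> lipfree x0) (e : 'I_n -> dual E) :
  represents (\sum_(k < l) lip_tens (x k) (y k) (s k)) m e <->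
  \sum_(i < n) tens (m i) (e i)
    = \sum_(k < l) tens (ldelta x0 (x k) (y k)) (s k).
Proof.
split=> [[l' [x' [y' [s' [eq_u ->]]]]]|mE]; last by exists l, x, y, s.
by apply: lip_tens_wd; rewrite eq_u.
Qed.

End LipTensor.

Arguments lip_tens {R X} x0 {E} x y s _.

Section Operators.
Context {R : realType}.

Definition strictly_lipschitz_summing (p : \bar R) (X : metricType R) (x0 : X)
    (E : normedModType R) (T : Lip0 x0 E) : Prop :=
  exists2 C : R, 0 < C & forall l (x y : 'I_l -> X) (s : 'I_l -> dual E),
    `|\sum_(k < l) s k (T (x k) - T (y k))|
      <= C * dL p (\sum_(k < l) lip_tens x0 (x k) (y k) (s k)).

Definition strictly_lipschitz_nuclear (p : \bar R) (X : metricType R) (x0 : X)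
    (E : normedModType R) (T : Lip0 x0 E) : Prop :=
  exists2 C : R, 0 < C & forall l (x y : 'I_l -> X) (s : 'I_l -> dual E),
    `|\sum_(k < l) s k (T (x k) - T (y k))|
      <= C * wSL p (\sum_(k < l) lip_tens x0 (x k) (y k) (s k)).

Definition cohen_strongly_summing (p : \bar R) (G E : normedModType R)
    (S : {linear G -> E}) : Prop :=
  exists2 C : R, 0 < C & forall n (x : 'I_n -> G) (y : 'I_n -> dual E),
    \sum_(i < n) `|y i (S (x i))|
      <= C * lp_strong p x * lp_weak (hoelder_conjugate p) y.

End Operators.

(* Main.v *)
(* Let B(m, e) = <T_L m, e> on F(X) x E^*, T_L being the linearization of T, let D
   be the span of the deltas and q the conjugate of p. Nuclearity of T reads
     |sum B(m_i, e_i)| <= C w_p(m) w_q(e)    for m_i in D.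
   By Young's inequality the right-hand side is at most C times the sum of a cost
   of m and of sup_k sum |k(e_i)|^q / q over the unit ball of E^{**}. Hahn-Banach on
   the bounded functions on that ball replaces this supremum by a finitely additive
   mean, i.e. yields an absolutely homogeneous g >= 0 on E^* with
     (sum g(e_i)^q)^(1/q) <= w_q(e),
     |sum B(m_i, e_i)| <= C w_p(m) (sum g(e_i)^q)^(1/q)
   (for p = 1 the norm serves as g). Then G is the space of all v in E that are
   bounded on {g <= 1}, normed by that supremum: it is already complete, S is its
   inclusion in E, and the summing factor is T itself. The converse combines norming
   functionals of G with the equality case of Hoelder's inequality; families in
   F(X) are reduced to families in D by density. *)

Require Import Defs.
From HB Require Import structures.
From mathcomp Require Import all_boot all_order all_algebra.
From mathcomp Require Import all_classical all_reals all_analysis.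
From mathcomp Require Import ring lra.

Set Implicit Arguments.
Unset Strict Implicit.
Unset Printing Implicit Defensive.

Import Order.TTheory GRing.Theory Num.Theory.
Import numFieldNormedType.Exports.

Local Open Scope classical_set_scope.
Local Open Scope ring_scope.

(** * Hahn-Banach *)

Section HahnBanach.
Context {R : realType} {V : lmodType R}.
Implicit Types (P : V -> R) (t : R) (u v : V).

Definition sublinear P :=
  (forall u v, P (u + v) <= P u + P v) /\
  (forall t u, 0 < t -> P (t *: u) <= t * P u).

Lemma sublinearZ P t u : sublinear P -> 0 < t -> P (t *: u) = t * P u.
Proof.
move=> [_ PZ] t0; apply/eqP; rewrite eq_le PZ//=.
rewrite -ler_pdivlMl// -{1}(scale1r u) -(mulVf (lt0r_neq0 t0)) -scalerA.
by rewrite PZ// invr_gt0.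
Qed.

Lemma sublinear0 P : sublinear P -> P 0 = 0.
Proof.
move=> sP; have := sublinearZ 0 sP (ltr0Sn R 1).
rewrite scaler0 mulr_natl mulr2n => /eqP.
by rewrite -subr_eq0 opprD addrA subrr sub0r oppr_eq0 => /eqP.
Qed.

Lemma sublinear_geN P u : sublinear P -> - P (- u) <= P u.
Proof.
move=> sP; rewrite lerNl -subr_ge0 opprK addrC.
by rewrite (le_trans _ (sP.1 u (- u)))// subrr sublinear0.
Qed.

(** Serves three infima: over [t >= 0] in [sub_toward], over a chain in Zorn's lemma, over a cone in
    [mean_nonneg_on_cone]. As the index may change between the two sides, a single [Phi i] need not
    be sublinear. *)
Lemma sublinear_inf (I : Type) (Phi : I -> V -> R) (i0 : I) :
  (forall i j u v, exists k, Phi k (u + v) <= Phi i u + Phi j v) ->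
  (forall i t u, 0 < t -> exists k, Phi k (t *: u) <= t * Phi i u) ->
  (forall u, exists M, forall i, M <= Phi i u) ->
  sublinear (fun u => inf (range (Phi^~ u))) /\
  (forall i u, inf (range (Phi^~ u)) <= Phi i u).
Proof.
move=> PhiD PhiZ Phib.
have hi u : has_inf (range (Phi^~ u)).
  split; first by exists (Phi i0 u), i0.
  by have [M uM] := Phib u; exists M => _ [i _ <-].
have infle i u : inf (range (Phi^~ u)) <= Phi i u.
  by apply: ge_inf; [case: (hi u)|exists i].
split => //; split=> [u v|t u t0].
  apply/ler_addgt0Pr => e e0; have e2 : 0 < e / 2 by rewrite divr_gt0.
  have [_ [i _ <-] iu] := inf_adherent e2 (hi u).
  have [_ [j _ <-] jv] := inf_adherent e2 (hi v).
  have [k kuv] := PhiD i j u v.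
  rewrite (le_trans (infle k _))// (le_trans kuv)//.
  by rewrite [in leRHS](splitr e) addrACA lerD// ltW.
rewrite -ler_pdivrMl//; apply: lb_le_inf; first by case: (hi u).
move=> _ [i _ <-]; have [k kt] := PhiZ i t u t0.
by rewrite ler_pdivrMl// (le_trans (infle k _)).
Qed.

(* A sublinear P that is minimal equals [sub_toward P v0], which forces
   P (- v0) = - P v0 and hence linearity. *)
Definition sub_toward P v0 : V -> R :=
  fun u => inf (range (fun t : {t : R | 0 <= t} =>
    P (u + val t *: v0) - val t * P v0)).

Lemma sub_towardP P v0 : sublinear P ->
  [/\ sublinear (sub_toward P v0), forall u, sub_toward P v0 u <= P u
    & sub_toward P v0 (- v0) <= - P v0].
Proof.
move=> sP; have [PD PZ] := sP.
have t0 : {t : R | 0 <= t} by exists 0.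
have [|||s sle] := @sublinear_inf {t : R | 0 <= t}
  (fun (t : {t : R | 0 <= t}) u => P (u + val t *: v0) - val t * P v0)
  (exist _ 0 (lexx 0)).
- move=> [a a0] [b b0] u v; exists (exist _ (a + b) (addr_ge0 a0 b0)) => /=.
  rewrite scalerDl addrACA mulrDl opprD (addrACA _ (- (a * _))).
  by rewrite lerD2r PD.
- move=> [a a0] t u t0'; exists (exist _ (t * a) (mulr_ge0 (ltW t0') a0)) => /=.
  by rewrite -scalerA -scalerDr mulrBr mulrA lerD2r PZ.
(* Finiteness: [a * P v0 = P (a *: v0) <= P (u + a *: v0) + P (- u)]. *)
- move=> u; exists (- P (- u)) => -[a a0] /=.
  rewrite lerBrDr; have [->|an0] := eqVneq a 0.
    by rewrite mul0r addr0 scale0r addr0 sublinear_geN.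
  have ap : 0 < a by rewrite lt_neqAle eq_sym an0.
  rewrite -(sublinearZ v0 sP ap) addrC lerBlDr.
  by rewrite (le_trans _ (PD _ _))// addrC addKr.
split=> // [u|].
  by have := sle (exist _ 0 (lexx 0)) u; rewrite /= scale0r addr0 mul0r subr0.
have := sle (exist _ 1 ler01) (- v0).
by rewrite /= scale1r addNr mul1r sublinear0// sub0r.
Qed.

(** Zorn's lemma for the reversed pointwise order. A chain is bounded by its pointwise infimum,
    finite because [- P (- u) <= - Q (- u) <= Q u] for every sublinear [Q] below [P]. *)
Lemma sublinear_minimal P : sublinear P ->
  exists Q, [/\ sublinear Q, forall u, Q u <= P u &
    forall Q', sublinear Q' -> (forall u, Q' u <= Q u) -> Q' = Q].
Proof.
move=> sP.
pose S := {Q : V -> R | sublinear Q /\ forall u, Q u <= P u}.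
pose le (Q1 Q2 : S) := `[< forall u, sval Q2 u <= sval Q1 u >].
have P0 : S by exists P; split.
have [|||A totA|Q maxQ] := @Zorn S le.
- by move=> Q; apply/asboolP.
- move=> Q1 Q2 Q3 /asboolP h12 /asboolP h23; apply/asboolP => u.
  exact: le_trans (h23 u) (h12 u).
- move=> [Q1 s1] [Q2 s2] /asboolP/= h12 /asboolP/= h21.
  have E : Q1 = Q2 by apply/funext => u; apply/eqP; rewrite eq_le h12 h21.
  by move: s1 s2 h12 h21; rewrite E => s1 s2 _ _; congr exist; exact: Prop_irrelevance.
- have [[Q0 AQ0]|A0] := pselect (A !=set0); last first.
    by exists P0 => s As; case: A0; exists s.
  have [|||sI leI] := @sublinear_inf {Q : S | A Q} (fun Q => sval (sval Q))
      (exist _ Q0 AQ0).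
  + move=> [Q1 A1] [Q2 A2] u v /=.
    case: (totA _ _ A1 A2) => /asboolP h.
      exists (exist _ Q2 A2) => /=; rewrite (le_trans ((svalP Q2).1.1 _ _))//.
      by rewrite lerD2r.
    exists (exist _ Q1 A1) => /=; rewrite (le_trans ((svalP Q1).1.1 _ _))//.
    by rewrite lerD2l.
  + move=> [Q1 A1] t u t0; exists (exist _ Q1 A1) => /=.
    exact: (svalP Q1).1.2.
  + move=> u; exists (- P (- u)) => -[Q1 A1] /=.
    rewrite (le_trans _ (sublinear_geN _ (svalP Q1).1))// lerN2.
    exact: (svalP Q1).2.
  pose I u := inf (range (fun Q : {Q : S | A Q} => sval (sval Q) u)).
  have IP : sublinear I /\ forall u, I u <= P u.
    split=> // u; rewrite (le_trans (leI (exist _ Q0 AQ0) u))//.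
    exact: (svalP Q0).2.
  exists (exist _ I IP) => Q1 A1; apply/asboolP => u /=.
  exact: (leI (exist _ Q1 A1) u).
have [sQ QP] := svalP Q.
exists (sval Q); split=> // Q' sQ' Q'Q.
have Q'P : sublinear Q' /\ forall u, Q' u <= P u.
  by split=> // u; rewrite (le_trans (Q'Q u)).
by have /(congr1 sval)/= := maxQ (exist _ Q' Q'P) (asboolT Q'Q).
Qed.

Theorem hahn_banach P : sublinear P ->
  exists2 L : V -> R, scalar L & forall u, L u <= P u.
Proof.
move=> /sublinear_minimal[L [sL LP Lmin]]; exists L => //.
have LN v : L (- v) = - L v.
  have [s sle sv] := sub_towardP v sL.
  apply/eqP; rewrite eq_le lerNl sublinear_geN// andbT.
  by rewrite -[X in X (- v) <= _](Lmin _ s sle).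
have LD u v : L (u + v) = L u + L v.
  apply/eqP; rewrite eq_le sL.1/= -lerN2 opprD -!LN opprD.
  exact: sL.1.
move=> a u v; rewrite LD; congr (_ + _).
have [a0|a0|->] := ltgtP a 0; last by rewrite scale0r mul0r sublinear0.
  by rewrite -[a]opprK scaleNr LN sublinearZ// ?mulNr// oppr_gt0.
by rewrite sublinearZ.
Qed.

(** A linear [L] below [sub_toward P v0] satisfies [- L v0 = L (- v0) <= - P v0], and [L <= P] gives
    the other inequality at [v0]. *)
Corollary hahn_banach_point P v0 : sublinear P ->
  exists L : V -> R, [/\ scalar L, forall u, L u <= P u & L v0 = P v0].
Proof.
move=> sP; have [s sle sv] := sub_towardP v0 sP.
have [L lL LP] := hahn_banach s.
have LleP u : L u <= P u by rewrite (le_trans (LP u)).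
exists L; split=> //; apply/eqP; rewrite eq_le LleP/= -lerN2.
have /= <- : L (- v0) = - L v0.
  have := lL (-1) v0 0; have := lL 1 0 0.
  rewrite scaler0 !addr0 mul1r => /eqP; rewrite -subr_eq0 opprD addNKr oppr_eq0.
  by move=> /eqP ->; rewrite scaleN1r addr0 mulN1r.
by rewrite (le_trans (LP _)).
Qed.

End HahnBanach.

Lemma norming_functional (R : realType) (V : normedModType R) (v : V) :
  exists2 phi : dual V, `|phi| <= 1 & phi v = `|v|.
Proof.
have sn : sublinear (fun u : V => `|u|).
  split=> [u w|t u t0]; first exact: ler_normD.
  by rewrite normrZ gtr0_norm.
have [L [lL Ln Lv]] := hahn_banach_point v sn.
pose LL : {scalar V} := HB.pack L (GRing.isLinear.Build R V R *%R L lL).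
have LLE u : LL u = L u by [].
have Labs u : `|L u| <= `|u|.
  rewrite ler_norml Ln andbT lerNl -LLE -linearN LLE.
  by rewrite (le_trans (Ln _))// normrN.
have LP : L \in dual_pred (V := V).
  apply/dual_predP; split=> //.
  apply: (@bounded_linear_continuous R V R LL).
  apply/linear_boundedP; exists 1; split; first exact: num_real.
  move=> r r1 x; rewrite LLE (le_trans (Labs x))//.
  by rewrite ler_peMl// ltW.
exists (Dual LP) => //; apply: dual_norm_le => x x1.
exact: le_trans (Labs x) x1.
Qed.

(** * Finitely additive means on bounded functions *)

Section BoundedFunctions.
Context {R : realType} {K : Type}.

Definition bounded_pred : {pred K -> R} :=
  fun f => `[< exists M, forall k, `|f k| <= M >].

Lemma bounded_predP (f : K -> R) :
  reflect (exists M, forall k, `|f k| <= M) (f \in bounded_pred).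
Proof. exact: asboolP. Qed.

Lemma bounded_submod_closed : submod_closed bounded_pred.
Proof.
split=> [|a f g /bounded_predP[M fM] /bounded_predP[N gN]]; apply/bounded_predP.
  by exists 0 => k; rewrite normr0.
exists (`|a| * M + N) => k; rewrite !fctE (le_trans (ler_normD _ _))// lerD//.
by rewrite normrM ler_wpM2l.
Qed.

HB.instance Definition _ :=
  GRing.isSubmodClosed.Build R (K -> R) bounded_pred bounded_submod_closed.

Record bounded_map : Type :=
  BoundedMap { bounded_val :> K -> R ; bounded_valP : bounded_val \in bounded_pred }.

HB.instance Definition _ := [isSub for bounded_val].
HB.instance Definition _ := [Choice of bounded_map by <:].
HB.instance Definition _ := [SubChoice_isSubZmodule of bounded_map by <:].
HB.instance Definition _ := [SubZmodule_isSubLmodule of bounded_map by <:].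

(* Hahn-Banach for [f |-> inf_(h in H) sup (f + h)], which is finite because no
   [h] in [H] is uniformly negative. *)
Lemma mean_nonneg_on_cone (k0 : K) (H : set bounded_map) (h0 : bounded_map) :
  H h0 ->
  (forall h1 h2, H h1 -> H h2 ->
     exists2 h, H h & forall k, h k <= h1 k + h2 k) ->
  (forall (t : R) h, 0 < t -> H h -> exists2 h', H h' & forall k, h' k <= t * h k) ->
  (forall h (e : R), H h -> 0 < e -> exists k, - e < h k) ->
  exists nu : bounded_map -> R, [/\ scalar nu,
    forall (f : bounded_map) M, (forall k, f k <= M) -> nu f <= M &
    forall h, H h -> 0 <= nu h].
Proof.
move=> Hh0 HD HZ Hge.
pose S (g : K -> R) := sup (range g).
have hs (f h : bounded_map) : has_sup (range (fun k => f k + h k)).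
  split; first by exists (f k0 + h k0), k0.
  have /bounded_predP[M fM] := bounded_valP f.
  have /bounded_predP[N hN] := bounded_valP h.
  exists (M + N) => _ [k _ <-]; rewrite (le_trans (ler_norm _))//.
  by rewrite (le_trans (ler_normD _ _))// lerD.
have leS (f h : bounded_map) k : f k + h k <= S (fun k => f k + h k).
  by apply: (sup_upper_bound (hs f h)); exists k.
have Sle (g : K -> R) M : (forall k, g k <= M) -> S g <= M.
  by move=> gM; apply: ge_sup; [exists (g k0), k0|move=> _ [k _ <-]].
have [|||sP leP] := @sublinear_inf R bounded_map {h | H h}
    (fun h f => S (fun k => f k + sval h k)) (exist _ h0 Hh0).
- move=> [h1 H1] [h2 H2] f g; have [h Hh hle] := HD _ _ H1 H2.
  exists (exist _ h Hh) => /=; apply: Sle => k.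
  rewrite (le_trans _ (lerD (leS f h1 k) (leS g h2 k)))//.
  by rewrite addrACA lerD2l.
- move=> [h1 H1] t f t0; have [h Hh hle] := HZ t _ t0 H1.
  exists (exist _ h Hh) => /=; apply: Sle => k.
  rewrite -ler_pdivrMl// (le_trans _ (leS f h1 k))// ler_pdivrMl// mulrDr.
  by rewrite lerD2l.
- move=> f; have /bounded_predP[M fM] := bounded_valP f.
  exists (- M) => -[h Hh] /=; apply/ler_addgt0Pr => e e0.
  have [k hk] := Hge _ _ Hh e0.
  rewrite -lerBlDr (le_trans _ (leS f h k))// lerD//; last exact: ltW.
  by have := fM k; rewrite ler_norml => /andP[].
have [nu lnu nuP] := hahn_banach sP.
have nu_le (f h : bounded_map) M : H h -> (forall k, f k + h k <= M) -> nu f <= M.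
  move=> Hh fM; rewrite (le_trans (nuP f))// (le_trans (leP (exist _ h Hh) f))//.
  exact: Sle.
pose nuL : {scalar bounded_map} :=
  HB.pack nu (GRing.isLinear.Build R bounded_map R *%R nu lnu).
exists nu; split=> // [f M fM|h Hh].
  apply/ler_addgt0Pr => e e0.
  have /bounded_predP[N hN] := bounded_valP h0.
  have N1 : 0 < `|N| + 1 by rewrite ltr_wpDl.
  (* A member of the cone below a small multiple of [h0] is at most [e] everywhere, so that the
     infimum at [f] is at most [M + e]. *)
  have [h Hh hle] := HZ (e / (`|N| + 1)) h0 (divr_gt0 e0 N1) Hh0.
  apply: (nu_le _ h) => // k; rewrite lerD// (le_trans (hle k))//.
  rewrite -mulrA ler_piMr ?(ltW e0)// ler_pdivrMl// mulr1.
  rewrite (le_trans (ler_norm _))// (le_trans (hN k))//.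
  by rewrite (le_trans (ler_norm _))// lerDl.
(* The index [h] itself, used at [- h], gives [nu (- h) <= 0]. *)
rewrite -lerN2 oppr0 -[nu h]/(nuL h) -linearN; apply: (nu_le _ h) => // k.
by rewrite addNr.
Qed.

End BoundedFunctions.

(** * Finite l_p norms *)

Section LpNorm.
Context {R : realType}.
Implicit Types (p : \bar R) (t : R) (n : nat).

Lemma hoelder_conjugate_cases p : (1 <= p)%E ->
  [\/ p = 1%E /\ hoelder_conjugate p = +oo%E,
      p = +oo%E /\ hoelder_conjugate p = 1%E |
      exists r s, [/\ 1 < r, 1 < s, r^-1 + s^-1 = 1, p = r%:E &
                      hoelder_conjugate p = s%:E]].
Proof.
case: p => [r||//]; last by move=> _; apply: Or32.
rewrite lee_fin le_eqVlt => /predU1P[<-|r1].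
  by apply: Or31; rewrite hoelder_conjugate1.
have r0 : 0 < r by rewrite (lt_trans _ r1).
apply: Or33; exists r, (r / (r - 1)); split=> //.
- by rewrite ltr_pdivlMr ?subr_gt0// mul1r ltrBlDr ltrDl.
- by rewrite invf_div mulrBl divff ?gt_eqF// mul1r addrC subrK.
- by rewrite /hoelder_conjugate/= eqe gt_eqF// -EFinD inver subr_eq0 gt_eqF.
Qed.

Lemma powRV (x r : R) : 0 <= x -> x^-1 `^ r = (x `^ r)^-1.
Proof. by move=> x0; rewrite -(powR_inv1 x0) -powRrM mulN1r powRN. Qed.

Lemma lp_norm1 n (a : 'I_n -> R) : lp_norm 1 a = \sum_i `|a i|.
Proof.
rewrite /lp_norm /= invr1 powRr1 ?sumr_ge0//.
by apply: eq_bigr => i _; rewrite powRr1.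
Qed.

Lemma lp_normy_ge n (a : 'I_n -> R) i : `|a i| <= lp_norm +oo a.
Proof. exact: le_bigmax. Qed.

Lemma lp_norm_ge0 p n (a : 'I_n -> R) : 0 <= lp_norm p a.
Proof. by case: p => [r||] //=; [exact: powR_ge0|exact: bigmax_ge_id]. Qed.

Lemma lp_norm_powR (r : R) n (a : 'I_n -> R) : r != 0 ->
  lp_norm r%:E a `^ r = \sum_i `|a i| `^ r.
Proof.
by move=> r0; rewrite -powRrM mulVf// powRr1// sumr_ge0.
Qed.

(** The equality case of Hölder's inequality. The weights are 1 for [p = 1], the indicator of a
    maximal coordinate for [p = +oo], and the powers [r - 1] of the normalized coordinates
    otherwise. *)
Lemma lp_norm_attained p n (a : 'I_n -> R) : (1 <= p)%E ->
  exists w : 'I_n -> R, [/\ forall i, 0 <= w i,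
    lp_norm (hoelder_conjugate p) w <= 1 & \sum_i w i * `|a i| = lp_norm p a].
Proof.
move=> /hoelder_conjugate_cases[[-> ->]|[-> ->]|[r [s [r1 s1 rs -> ->]]]].
- exists (fun=> 1); split=> //; last first.
    by rewrite lp_norm1; apply: eq_bigr => i _; rewrite mul1r.
  by apply: bigmax_le => // i _; rewrite normr1.
(* A zero norm is set apart because [n] may be 0, and then no coordinate attains the maximum. *)
- have [a0|a0] := eqVneq (lp_norm +oo a) 0.
    exists (fun=> 0); split=> //; last first.
      by rewrite a0 big1// => i _; rewrite mul0r.
    by rewrite lp_norm1 big1 ?ler01// => i _; rewrite normr0.
  have [i ai] : exists i, lp_norm +oo a = `|a i|.
    move: a0; rewrite /lp_norm; elim/big_ind: _ => [|x y IHx IHy|i _ _]; last by exists i.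
      by rewrite eqxx.
    by rewrite /Num.max; case: ifPn.
  exists (fun j => (j == i)%:R); split=> //.
    rewrite lp_norm1 (bigD1 i)//= eqxx normr1 big1 ?addr0// => j /negbTE ->.
    by rewrite normr0.
  rewrite (bigD1 i)//= eqxx mul1r big1 ?addr0// => j /negbTE ->.
  by rewrite mul0r.
have r0 : 0 < r by rewrite (lt_trans _ r1).
have s0 : 0 < s by rewrite (lt_trans _ s1).
pose A := lp_norm r%:E a.
have [A0|A0] := eqVneq A 0.
  exists (fun=> 0); split=> //; last first.
    by rewrite -[RHS]/A A0 big1// => i _; rewrite mul0r.
  rewrite /lp_norm big1 ?powR0 ?invr_neq0 ?gt_eqF// => i _.
  by rewrite normr0 powR0// gt_eqF.
have Ap : 0 < A by rewrite lt_neqAle eq_sym A0 lp_norm_ge0.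
(* With this identity the [s]-th powers of the weights are [r]-th powers of normalized coordinates,
   hence sum to 1. *)
have rsE : (r - 1) * s = r.
  have : r * s * (r^-1 + s^-1) = r * s by rewrite rs mulr1.
  rewrite mulrDr -[r * s * s^-1]mulrA divff ?gt_eqF// mulr1 mulrAC divff ?gt_eqF//.
  by rewrite mul1r mulrBl mul1r => <-; rewrite addrAC subrr add0r.
have srA : \sum_i `|a i| `^ r = A `^ r by rewrite lp_norm_powR ?gt_eqF.
exists (fun i => `|a i| `^ (r - 1) / A `^ (r - 1)); split=> [i||].
- by rewrite divr_ge0// powR_ge0.
- rewrite /lp_norm (eq_bigr (fun i => `|a i| `^ r / A `^ r)) => [|i _].
    by rewrite -mulr_suml srA divff ?powR1// gt_eqF// powR_gt0.
  rewrite ger0_norm ?divr_ge0 ?powR_ge0// powRM ?invr_ge0 ?powR_ge0//.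
  by rewrite (@powRV (A `^ (r - 1)) s (powR_ge0 _ _)) -!powRrM rsE.
- rewrite (eq_bigr (fun i => `|a i| `^ r / A `^ (r - 1))) => [|i _].
    rewrite -mulr_suml srA -(mulr_powRB1 (ltW Ap) r0).
    by rewrite mulfK// gt_eqF// powR_gt0.
  by rewrite mulrAC [X in X / _]mulrC mulr_powRB1.
Qed.

(** For [1 < p < +oo], Young's inequality is applied to each coordinate of the families scaled to
    norm 1, and the bounds add up to [r^-1 + s^-1 = 1]. A family of norm 0 vanishes and is treated
    first. *)
Lemma lp_hoelder p n (a b : 'I_n -> R) : (1 <= p)%E ->
  \sum_i `|a i| * `|b i| <= lp_norm p a * lp_norm (hoelder_conjugate p) b.
Proof.
have h1y (c d : 'I_n -> R) : \sum_i `|c i| * `|d i| <= lp_norm 1 c * lp_norm +oo d.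
  rewrite lp_norm1 mulr_suml; apply: ler_sum => i _.
  by rewrite ler_wpM2l// lp_normy_ge.
move=> /hoelder_conjugate_cases[[-> ->]|[-> ->]|[r [s [r1 s1 rs -> ->]]]].
- exact: h1y.
- by rewrite mulrC; under eq_bigr do rewrite mulrC; exact: h1y.
have r0 : 0 < r by rewrite (lt_trans _ r1).
have s0 : 0 < s by rewrite (lt_trans _ s1).
have eq0 (q : R) (c : 'I_n -> R) : 0 < q -> lp_norm q%:E c = 0 -> forall i, `|c i| = 0.
  move=> q0 /powR_eq0_eq0 /eqP c0 i; move: c0.
  rewrite psumr_eq0 => [/allP/(_ i)|j _]; last exact: powR_ge0.
  by rewrite mem_index_enum powR_eq0 => /(_ isT)/andP[/eqP].
have unit (q : R) (c : 'I_n -> R) : 0 < q -> lp_norm q%:E c != 0 ->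
    0 < lp_norm q%:E c /\ \sum_i (`|c i| / lp_norm q%:E c) `^ q = 1.
  move=> q0 c0; split; first by rewrite lt_neqAle eq_sym c0 lp_norm_ge0.
  rewrite (eq_bigr (fun i => `|c i| `^ q / lp_norm q%:E c `^ q)).
    by rewrite -mulr_suml -lp_norm_powR ?gt_eqF// divff// powR_eq0 (negbTE c0).
  move=> i _; rewrite powRM ?invr_ge0 ?lp_norm_ge0//.
  by rewrite (powRV q (lp_norm_ge0 q%:E c)).
have [A0|/(unit r a r0)] := eqVneq (lp_norm r%:E a) 0.
  by rewrite A0 mul0r big1// => i _; rewrite (eq0 r a r0)// mul0r.
have [B0 _|/(unit s b s0)] := eqVneq (lp_norm s%:E b) 0.
  by rewrite B0 mulr0 big1// => i _; rewrite (eq0 s b s0)// mulr0.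
move: (lp_norm r%:E a) (lp_norm s%:E b) => A B [Bp hB] [Ap hA].
rewrite -[leRHS]mul1r -(ler_pdivrMr _ _ (mulr_gt0 Ap Bp)) mulr_suml -rs.
have -> : r^-1 + s^-1 = \sum_i ((`|a i| / A) `^ r / r + (`|b i| / B) `^ s / s).
  by rewrite big_split -!mulr_suml hA hB !mul1r.
apply: ler_sum => i _; rewrite invfM mulrACA.
by apply: conjugate_powR; rewrite ?divr_ge0 ?(ltW Ap) ?(ltW Bp).
Qed.

(** Duality: with [lp_norm_ge], the norm is a maximum of weighted sums over nonnegative weights in
    the conjugate unit ball. Monotonicity, the triangle inequality and homogeneity then follow for
    all [p] at once. *)
Lemma lp_norm_le p n (a : 'I_n -> R) C : (1 <= p)%E ->
  (forall w : 'I_n -> R, (forall i, 0 <= w i) ->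
     lp_norm (hoelder_conjugate p) w <= 1 -> \sum_i w i * `|a i| <= C) ->
  lp_norm p a <= C.
Proof. by move=> /(@lp_norm_attained p n a)[w [w0 w1 <-]]; exact. Qed.

Lemma lp_norm_ge p n (a w : 'I_n -> R) : (1 <= p)%E -> (forall i, 0 <= w i) ->
  lp_norm (hoelder_conjugate p) w <= 1 -> \sum_i w i * `|a i| <= lp_norm p a.
Proof.
move=> p1 w0 w1; rewrite (le_trans _ (ler_piMr (lp_norm_ge0 p a) w1))//.
rewrite (le_trans _ (lp_hoelder a w p1))// ler_sum// => i _.
by rewrite mulrC (ger0_norm (w0 i)).
Qed.

Lemma le_lp_norm p n (a b : 'I_n -> R) : (1 <= p)%E ->
  (forall i, `|a i| <= `|b i|) -> lp_norm p a <= lp_norm p b.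
Proof.
move=> p1 ab; apply: lp_norm_le => // w w0 w1.
rewrite (le_trans _ (lp_norm_ge b p1 w0 w1))// ler_sum// => i _.
by rewrite ler_wpM2l.
Qed.

Lemma lp_normD p n (a b : 'I_n -> R) : (1 <= p)%E ->
  lp_norm p (fun i => a i + b i) <= lp_norm p a + lp_norm p b.
Proof.
move=> p1; apply: lp_norm_le => // w w0 w1.
rewrite (le_trans _ (lerD (lp_norm_ge a p1 w0 w1) (lp_norm_ge b p1 w0 w1)))//.
rewrite -big_split/= ler_sum// => i _.
by rewrite -mulrDr ler_wpM2l// ler_normD.
Qed.

Lemma lp_normZ p n t (a : 'I_n -> R) : (1 <= p)%E ->
  lp_norm p (fun i => t * a i) = `|t| * lp_norm p a.
Proof.
move=> p1.
have leZ u (b : 'I_n -> R) : lp_norm p (fun i => u * b i) <= `|u| * lp_norm p b.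
  apply: lp_norm_le => // w w0 w1.
  rewrite (le_trans _ (ler_wpM2l _ (lp_norm_ge b p1 w0 w1)))// mulr_sumr.
  by rewrite ler_sum// => i _; rewrite normrM mulrCA.
apply/eqP; rewrite eq_le leZ/=.
have [->|t0] := eqVneq t 0; first by rewrite normr0 mul0r lp_norm_ge0.
rewrite -ler_pdivlMl ?normr_gt0// -normfV (le_trans _ (leZ _ _))//.
apply: le_lp_norm => // i.
by rewrite mulrA mulVf// mul1r.
Qed.

Lemma lp_norm_coord p n (a : 'I_n -> R) i : (1 <= p)%E -> `|a i| <= lp_norm p a.
Proof.
case: p => [r|_|//]; last exact: lp_normy_ge.
rewrite lee_fin => r1; have r0 : 0 < r by rewrite (lt_le_trans _ r1).
rewrite -[leLHS]powRr1// -(divff (lt0r_neq0 r0)) powRrM.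
apply: ge0_ler_powR; rewrite ?nnegrE ?invr_ge0 ?powR_ge0 ?(ltW r0)//.
  by rewrite sumr_ge0// => j _; exact: powR_ge0.
by rewrite (bigD1 i)//= lerDl sumr_ge0// => j _; exact: powR_ge0.
Qed.

Lemma lp_norm_le_sum p n (a : 'I_n -> R) : (1 <= p)%E ->
  lp_norm p a <= \sum_i `|a i|.
Proof.
move=> p1; apply: lp_norm_le => // w w0 w1; apply: ler_sum => i _.
rewrite ler_piMl// -(ger0_norm (w0 i)) (le_trans _ w1)//.
exact/lp_norm_coord/hoelder_conj_ge1.
Qed.

End LpNorm.

Definition fcat (T : Type) n1 n2 (f1 : 'I_n1 -> T) (f2 : 'I_n2 -> T) :
    'I_(n1 + n2) -> T :=
  fun i => match fintype.split i with inl j => f1 j | inr j => f2 j end.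

Lemma sum_fcat (V : zmodType) (T1 T2 : Type) (F : T1 -> T2 -> V) n1 n2
    (f1 : 'I_n1 -> T1) (f2 : 'I_n2 -> T1) (g1 : 'I_n1 -> T2) (g2 : 'I_n2 -> T2) :
  \sum_i F (fcat f1 f2 i) (fcat g1 g2 i) =
  \sum_i F (f1 i) (g1 i) + \sum_i F (f2 i) (g2 i).
Proof.
rewrite big_split_ord /=; congr (_ + _); apply: eq_bigr => i _.
  by rewrite /fcat (unsplitK (inl i)).
by rewrite /fcat (unsplitK (inr i)).
Qed.

Lemma forall_fcat (T : Type) (P : T -> Prop) n1 n2
    (f1 : 'I_n1 -> T) (f2 : 'I_n2 -> T) :
  (forall i, P (f1 i)) -> (forall i, P (f2 i)) -> forall i, P (fcat f1 f2 i).
Proof. by move=> P1 P2 i; rewrite /fcat; case: fintype.split. Qed.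

Lemma ler_dual_apply (R : realType) (V : normedModType R) (f : dual V) x :
  `|f x| <= `|f| * `|x|.
Proof. exact: ler_dual_norm_apply. Qed.

(** * Weak norms of families *)

Section LpWeak.
Context {R : realType} (p : \bar R) (p1 : (1 <= p)%E).

Lemma lp_weak_has_sup (V : normedModType R) n (e : 'I_n -> V) :
  has_sup [set lp_norm p (fun i => phi (e i)) | phi in [set phi : dual V | `|phi| <= 1]].
Proof.
split; first by eexists; exists 0 => //=; rewrite normr0.
exists (\sum_i `|e i|) => _ [phi /= phi1 <-].
rewrite (le_trans (lp_norm_le_sum _ p1))//; apply: ler_sum => i _.
by rewrite (le_trans (ler_dual_apply _ _))// ler_piMl.
Qed.

Lemma lp_weak_ge (V : normedModType R) n (e : 'I_n -> V) (phi : dual V) :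
  `|phi| <= 1 -> lp_norm p (fun i => phi (e i)) <= lp_weak p e.
Proof.
by move=> phi1; apply: (sup_upper_bound (lp_weak_has_sup e)); exists phi.
Qed.

Lemma lp_weak_le (V : normedModType R) n (e : 'I_n -> V) C :
  (forall phi : dual V, `|phi| <= 1 -> lp_norm p (fun i => phi (e i)) <= C) ->
  lp_weak p e <= C.
Proof.
move=> eC; apply: ge_sup; first by case: (lp_weak_has_sup e).
by move=> _ [phi /= phi1 <-]; exact: eC.
Qed.

Lemma lp_weak_ge0 (V : normedModType R) n (e : 'I_n -> V) : 0 <= lp_weak p e.
Proof. by rewrite (le_trans _ (lp_weak_ge e (phi := 0) _)) ?lp_norm_ge0 ?normr0. Qed.

Lemma lp_weak_perturb (V : normedModType R) n (e e' : 'I_n -> V) :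
  lp_weak p e <= lp_weak p e' + \sum_i `|e i - e' i|.
Proof.
apply: lp_weak_le => phi phi1.
have -> : (fun i => phi (e i)) = (fun i => phi (e' i) + phi (e i - e' i)).
  by apply/funext => i; rewrite -linearD addrC subrK.
rewrite (le_trans (lp_normD _ _ p1))// lerD ?lp_weak_ge//.
rewrite (le_trans (lp_norm_le_sum _ p1))//; apply: ler_sum => i _.
by rewrite (le_trans (ler_dual_apply _ _))// ler_piMl.
Qed.

Lemma lp_weak_le_sum (V : normedModType R) n (e : 'I_n -> V) :
  lp_weak p e <= \sum_i `|e i|.
Proof.
apply: lp_weak_le => phi phi1.
rewrite (le_trans (lp_norm_le_sum _ p1))//; apply: ler_sum => i _.
by rewrite (le_trans (ler_dual_apply _ _))// ler_piMl.
Qed.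

Lemma lp_weakZ (V : normedModType R) n (t : R) (e : 'I_n -> V) :
  lp_weak p (fun i => t *: e i) <= `|t| * lp_weak p e.
Proof.
apply: lp_weak_le => phi phi1; under eq_fun do rewrite linearZ.
by rewrite lp_normZ// ler_wpM2l// lp_weak_ge.
Qed.

End LpWeak.

(** * The linearization of a Lipschitz operator *)

Section Pairing.
Context {R : realType} {X : metricType R} {x0 : X} {E : normedModType R}.
Implicit Types (T : Lip0 x0 E) (s : dual E) (m : lipfree x0).

Lemma lip_comp_subproof T s : (fun x => s (T x)) \in lip0_pred x0 (V := R).
Proof.
apply/lip0_predP; split; first by rewrite lip0_base linear0.
exists (`|s| * lip_norm T) => x y; rewrite -linearB.
by rewrite (le_trans (ler_dual_apply _ _))// -mulrA ler_wpM2l ?ler_lip_norm.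
Qed.

Definition lip_comp T s : Lip0 x0 R := MkLip0 (lip_comp_subproof T s).

(* The bilinear form [<T_L m, s>] of the linearization [T_L : F(X) -> E] of [T],
   defined without extending [T] by density. *)
Definition lip_pair T m s : R := m (lip_comp T s).

Lemma lip_pair_bilinear T : bilinear_for
  (GRing.Scale.Law.clone _ _ *%R _) (GRing.Scale.Law.clone _ _ *%R _) (lip_pair T).
Proof.
split=> [s|m] a u v //=.
have -> : lip_pair T m (a *: u + v) = m (a *: lip_comp T u + lip_comp T v).
  by congr (lipfree_val m _); apply: val_inj; apply/funext.
exact: linearP.
Qed.

HB.instance Definition _ T :=
  bilinear_isBilinear.Build R _ _ _ _ _ (lip_pair T) (lip_pair_bilinear T).

Lemma lip_pairZr T m a s : lip_pair T m (a *: s) = a * lip_pair T m s.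
Proof. exact: linearZr_LR. Qed.

Lemma lip_pair_delta T x y s : lip_pair T (ldelta x0 x y) s = s (T x - T y).
Proof. by rewrite linearB. Qed.

Lemma ler_lip_pair T m s : `|lip_pair T m s| <= `|m| * (lip_norm T * `|s|).
Proof.
rewrite (le_trans (ler_dual_apply _ _))// ler_wpM2l//.
apply: lip_norm_le => [|x y]; first by rewrite mulr_ge0 ?lip_norm_ge0.
rewrite -[X in `|X|]/(s (T x) - s (T y)) -linearB.
rewrite (le_trans (ler_dual_apply _ _))// mulrC mulrAC.
by rewrite ler_wpM2r ?ler_lip_norm.
Qed.

(** Tensors are functionals on bilinear forms; the identity is the equality of two tensors evaluated
    at the form [lip_pair T]. *)
Lemma represents_pair T l (x y : 'I_l -> X) (s : 'I_l -> dual E)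
    n (m : 'I_n -> lipfree x0) (e : 'I_n -> dual E) :
  represents (\sum_(k < l) lip_tens x0 (x k) (y k) (s k)) m e ->
  \sum_(k < l) s k (T (x k) - T (y k)) = \sum_(i < n) lip_pair T (m i) (e i).
Proof.
move=> /representsP me.
have := congr1 (fun t => t (lip_pair T : {bilinear _ -> _ -> R | *%R & *%R})) me.
rewrite !fct_sumE /tens => ->.
by apply: eq_bigr => k _; rewrite -lip_pair_delta.
Qed.

(** Expanding every [m i] in deltas and moving the coefficients into the functionals makes any
    family in the span a representation of some Lipschitz tensor. *)
Lemma delta_span_represents n (m : 'I_n -> lipfree x0) (e : 'I_n -> dual E) :
  (forall i, delta_span (m i)) ->
  exists l (x y : 'I_l -> X) (s : 'I_l -> dual E),
    represents (\sum_(k < l) lip_tens x0 (x k) (y k) (s k)) m e.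
Proof.
move=> Dm.
suff [l [x [y [s me]]]] : exists l (x y : 'I_l -> X) (s : 'I_l -> dual E),
    \sum_(i < n) tens (m i) (e i)
      = \sum_(k < l) tens (ldelta x0 (x k) (y k)) (s k).
  by exists l, x, y, s; apply/representsP.
elim/big_ind: _ => [|t1 t2 [l1 [x1 [y1 [s1 ->]]]] [l2 [x2 [y2 [s2 ->]]]]|i _].
- by exists 0%N, (fun=> x0), (fun=> x0), (fun=> 0); rewrite big_ord0.
- exists (l1 + l2)%N, (fcat x1 x2), (fcat y1 y2), (fcat s1 s2).
  rewrite big_split_ord /=; congr (_ + _); apply: eq_bigr => i _.
    by rewrite /fcat (unsplitK (inl i)).
  by rewrite /fcat (unsplitK (inr i)).
- have [l [a [x [y mE]]]] := Dm i.
  exists l, x, y, (fun k => a k *: e i); apply/funext => B.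
  have {}mE : m i = \sum_(k < l) a k *: ldelta x0 (x k) (y k).
    apply: val_inj; rewrite /= mE.
    by apply: (big_ind2 (fun u (v : lipfree x0) => u = val v)) => // u v u' v' -> ->.
  rewrite fct_sumE /tens mE linear_sumlz; apply: eq_bigr => k _.
  by rewrite linearZl_LR linearZr_LR.
Qed.

(** The vector is [T_L m], a finite combination of differences of values of [T]. *)
Lemma delta_span_vector m : delta_span m ->
  forall T, exists v : E, forall s, lip_pair T m s = s v.
Proof.
move=> [l [a [x [y mE]]]] T; exists (\sum_(k < l) a k *: (T (x k) - T (y k))) => s.
rewrite /lip_pair mE linear_sum.
pose ev (m' : dual (Lip0 x0 R)) := m' (lip_comp T s).
have ev0 : ev 0 = 0 by [].
have evD : {morph ev : u w / u + w >-> u + w} by [].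
rewrite -[LHS]/(ev _) (big_morph ev evD ev0); apply: eq_bigr => k _.
by rewrite linearZ linearB.
Qed.

Lemma lip_pair_density (p : \bar R) T n (e : 'I_n -> dual E) K :
  (1 <= p)%E -> 0 <= K ->
  (forall m : 'I_n -> lipfree x0, (forall i, delta_span (m i)) ->
     `|\sum_i lip_pair T (m i) (e i)| <= lp_weak p m * K) ->
  forall m : 'I_n -> lipfree x0,
    `|\sum_i lip_pair T (m i) (e i)| <= lp_weak p m * K.
Proof.
move=> p1 K0 DK m; pose Le := \sum_i lip_norm T * `|e i|.
have Le0 : 0 <= Le by rewrite sumr_ge0// => i _; rewrite mulr_ge0 ?lip_norm_ge0.
(* Moving each [m i] by less than [d] changes the right side by at most [n * d * K] and the left by
   at most [d * Le]; the summand 1 keeps [D] positive. *)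
pose D := n%:R * K + Le + 1.
have D0 : 0 < D by rewrite ltr_wpDl// addr_ge0// mulr_ge0.
apply/ler_addgt0Pr => eps eps0.
pose d := eps / D; have d0 : 0 < d by rewrite divr_gt0.
have /choice[m' mm'] : forall i, exists m' : lipfree x0,
    delta_span m' /\ `|m i - m'| < d.
  move=> i; have /lipfree_predP/(_ _ d0)[m' Dm' mm'] := lipfree_valP (m i).
  have m'P : m' \in lipfree_pred (x0 := x0).
    by apply/lipfree_predP => r r0; exists m' => //; rewrite subrr normr0.
  by exists (MkLipfree m'P).
have -> : \sum_i lip_pair T (m i) (e i) =
    \sum_i lip_pair T (m' i) (e i) + \sum_i lip_pair T (m i - m' i) (e i).
  by rewrite -big_split; apply: eq_bigr => i _ /=; rewrite linearBl addrC subrK.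
rewrite (le_trans (ler_normD _ _))//.
have h1 : `|\sum_i lip_pair T (m' i) (e i)| <= (lp_weak p m + n%:R * d) * K.
  rewrite (le_trans (DK m' (fun i => (mm' i).1)))// ler_wpM2r//.
  rewrite (le_trans (lp_weak_perturb p1 m' m))// lerD2l.
  rewrite mulr_natl -[X in _ *+ X]card_ord -sumr_const ler_sum// => i _.
  by rewrite distrC ltW// (mm' i).2.
have h2 : `|\sum_i lip_pair T (m i - m' i) (e i)| <= d * Le.
  rewrite (le_trans (ler_norm_sum _ _ _))// /Le mulr_sumr ler_sum// => i _.
  rewrite (le_trans (ler_lip_pair _ _ _))// ler_wpM2r ?mulr_ge0 ?lip_norm_ge0//.
  by rewrite ltW// (mm' i).2.
rewrite (le_trans (lerD h1 h2))// mulrDl -addrA lerD2l.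
have -> : eps = d * D by rewrite divfK// gt_eqF.
by rewrite (mulrC n%:R d) -mulrA -mulrDr ler_pM2l// lerDl.
Qed.

(** With the strong or the weak conjugate norm for [N], this turns the definitions of summing and
    nuclear operators into a bound over families in the span. The reverse implication uses density,
    since a representation may contain elements of F(X) outside the span. *)
Lemma le_inf_representsP (p : \bar R) (p1 : (1 <= p)%E) T
    (N : forall n, ('I_n -> dual E) -> R) :
  (forall n (e : 'I_n -> dual E), 0 <= N n e) ->
  (exists2 C : R, 0 < C & forall l (x y : 'I_l -> X) (s : 'I_l -> dual E),
    `|\sum_(k < l) s k (T (x k) - T (y k))| <= C *
      inf [set r | exists n (m : 'I_n -> lipfree x0) (e : 'I_n -> dual E),
        represents (\sum_(k < l) lip_tens x0 (x k) (y k) (s k)) m e /\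
        r = lp_weak p m * N n e]) <->
  (exists2 C : R, 0 < C & forall n (m : 'I_n -> lipfree x0) (e : 'I_n -> dual E),
    (forall i, delta_span (m i)) ->
    `|\sum_i lip_pair T (m i) (e i)| <= C * (lp_weak p m * N n e)).
Proof.
move=> N0; split=> [] [C C0 TC]; exists C => //.
  move=> n m e Dm; have [l [x [y [s us]]]] := delta_span_represents e Dm.
  rewrite -(represents_pair _ us) (le_trans (TC _ _ _ _))// ler_pM2l//.
  apply: ge_inf; last by exists n, m, e.
  by exists 0 => _ [n' [m' [e' [_ ->]]]]; rewrite mulr_ge0 ?lp_weak_ge0.
move=> l x y s; rewrite -ler_pdivrMl//; apply: lb_le_inf.
  (* The deltas of the tensor themselves form a representation, so the infimum runs over a nonempty
     set. *)
  eexists; exists l, (fun k => ldelta x0 (x k) (y k)), s; split; last by [].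
  exact/representsP.
move=> _ [n [m [e [us ->]]]]; rewrite ler_pdivrMl// (represents_pair _ us) mulrCA.
apply: lip_pair_density => // [|m' Dm']; first by rewrite mulr_ge0// ltW.
by rewrite mulrCA TC.
Qed.

End Pairing.

(** * Banach spaces of vectors bounded on a set of functionals *)

Section PolarSpace.
Context {R : realType} {E : completeNormedModType R} (Q : set (dual E)).

Definition polar_pred : {pred E} :=
  fun v => `[< exists K : R, forall phi, Q phi -> `|phi v| <= K >].

Lemma polar_predP (v : E) :
  reflect (exists K : R, forall phi, Q phi -> `|phi v| <= K) (v \in polar_pred).
Proof. exact: asboolP. Qed.

Lemma polar_submod_closed : submod_closed polar_pred.
Proof.
split=> [|a u v /polar_predP[K uK] /polar_predP[L vL]]; apply/polar_predP.
  by exists 0 => phi _; rewrite linear0 normr0.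
exists (`|a| * K + L) => phi Qphi; rewrite linearP (le_trans (ler_normD _ _))//.
by rewrite normrM lerD ?ler_wpM2l ?uK ?vL.
Qed.

HB.instance Definition _ :=
  GRing.isSubmodClosed.Build R E polar_pred polar_submod_closed.

Record polar_space : Type :=
  PolarSpace { polar_val :> E ; polar_valP : polar_val \in polar_pred }.

HB.instance Definition _ := [isSub for polar_val].
HB.instance Definition _ := [Choice of polar_space by <:].
HB.instance Definition _ := [SubChoice_isSubZmodule of polar_space by <:].
HB.instance Definition _ := [SubZmodule_isSubLmodule of polar_space by <:].

(* Including the dual unit ball in the supremum makes [polar_norm]
   separated and the inclusion into [E] contractive. *)
Definition polar_norm (v : polar_space) : R :=
  sup [set `|phi (polar_val v)| | phi in [set phi : dual E | Q phi \/ `|phi| <= 1]].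

Lemma polar_norm_ge (v : polar_space) (phi : dual E) :
  Q phi \/ `|phi| <= 1 -> `|phi (polar_val v)| <= polar_norm v.
Proof.
move=> Qphi; apply: sup_upper_bound; last by exists phi.
split; first by eexists; exists 0; [right; rewrite normr0|].
have /polar_predP[K vK] := polar_valP v.
exists (`|K| + `|polar_val v|) => _ [psi /= [Qpsi|psi1] <-].
  by rewrite (le_trans (vK _ Qpsi))// (le_trans (ler_norm K))// lerDl.
by rewrite (le_trans (ler_dual_apply _ _))// ler_wpDl// ler_piMl.
Qed.

Lemma polar_norm_le (v : polar_space) C :
  (forall phi : dual E, Q phi \/ `|phi| <= 1 -> `|phi (polar_val v)| <= C) ->
  polar_norm v <= C.
Proof.
move=> vC; apply: ge_sup; first by eexists; exists 0; [right; rewrite normr0|].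
by move=> _ [phi /= Qphi <-]; exact: vC.
Qed.

Lemma norm_le_polar_norm (v : polar_space) : `|polar_val v| <= polar_norm v.
Proof.
have [phi phi1 phiv] := norming_functional (polar_val v).
rewrite -[leLHS]normr_id -phiv.
by apply: polar_norm_ge; right.
Qed.

Lemma polar_normD (u v : polar_space) :
  polar_norm (u + v) <= polar_norm u + polar_norm v.
Proof.
apply: polar_norm_le => phi Qphi; rewrite linearD (le_trans (ler_normD _ _))//.
by rewrite lerD ?polar_norm_ge.
Qed.

Lemma polar_normZ (a : R) (v : polar_space) :
  polar_norm (a *: v) = `|a| * polar_norm v.
Proof.
have le_Z b u : polar_norm (b *: u) <= `|b| * polar_norm u.
  apply: polar_norm_le => phi Qphi.
  by rewrite linearZ normrM ler_wpM2l// polar_norm_ge.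
apply/eqP; rewrite eq_le le_Z/=.
have [->|a0] := eqVneq a 0.
  by rewrite normr0 mul0r (le_trans _ (norm_le_polar_norm _)).
rewrite -ler_pdivlMl ?normr_gt0// -normfV.
by rewrite -{1}(scale1r v) -(mulVf a0) -scalerA.
Qed.

Lemma polar_norm0_eq0 (v : polar_space) : polar_norm v = 0 -> v = 0.
Proof.
move=> v0; apply: val_inj; apply/eqP.
by rewrite -normr_le0 (le_trans (norm_le_polar_norm v))// v0.
Qed.

HB.instance Definition _ := Lmodule_isNormed.Build R polar_space
  polar_normD polar_normZ polar_norm0_eq0.

(** The inclusion in [E] being contractive, a Cauchy filter has a limit [v] in [E]. The bounds on
    each [phi] pass to [v] uniformly over the functionals of the norm, so [v] lies in the space and
    is the limit there. *)
Lemma polar_space_complete (F : set_system polar_space) :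
  ProperFilter F -> cauchy F -> cvg F.
Proof.
move=> FF /cauchyP Fc.
have Fball e : 0 < e -> exists x : polar_space, F [set y | `|x - y| < e].
  by move=> e0; have [x Fx] := Fc _ e0; exists x; move: Fx; rewrite -ball_normE.
have : cauchy (polar_val @ F).
  apply: cauchy_exP => e e0; have [x Fx] := Fball _ e0.
  exists (polar_val x).
  suff : F (polar_val @^-1` ball (polar_val x) e) by [].
  apply: filterS Fx => y /= xy; rewrite -ball_normE /=.
  exact: le_lt_trans (norm_le_polar_norm (x - y)) xy.
move=> /cauchy_cvg /cvg_ex[/= v Fv].
have close e (x : polar_space) : F [set y | `|x - y| < e] ->
    forall phi, Q phi \/ `|phi| <= 1 -> `|phi (polar_val x - v)| <= e.
  move=> Fx phi Qphi; apply/ler_addgt0Pr => eta eta0.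
  (* How close [y] must be to [v] in [E] depends on [phi]; the resulting bound [e] does not. *)
  have d0 : 0 < eta / (`|phi| + 1) by rewrite divr_gt0// ltr_wpDl.
  have Fv' : F [set y | `|v - polar_val y| < eta / (`|phi| + 1)].
    by move/cvgrPdist_lt : Fv; apply.
  have [y [/= xy vy]] := filter_ex (filterI Fx Fv').
  have -> : polar_val x - v = polar_val (x - y) - (v - polar_val y).
    by rewrite /= opprB addrA subrK.
  rewrite linearB (le_trans (ler_normB _ _))// lerD//.
    by rewrite (le_trans (polar_norm_ge _ Qphi))// ltW.
  rewrite (le_trans (ler_dual_apply _ _))//.
  rewrite (le_trans (ler_wpM2l _ (ltW vy)))// mulrCA ler_piMr ?(ltW eta0)//.
  by rewrite ler_pdivrMr ?ltr_wpDl// mul1r lerDl.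
have vP : v \in polar_pred.
  have [x Fx] := Fball 1 ltr01; apply/polar_predP; exists (polar_norm x + 1).
  move=> phi Qphi; have Qphi' : Q phi \/ `|phi| <= 1 by left.
  rewrite -[v](subKr (polar_val x)) linearB (le_trans (ler_normB _ _))// lerD//.
    exact: polar_norm_ge.
  exact: close.
apply/cvg_ex; exists (PolarSpace vP); apply/cvgrPdist_lt => e e0.
have e2 : 0 < e / 2 by rewrite divr_gt0.
have [x Fx] := Fball _ e2; apply: filterS (Fx) => y /= xy.
have vx : `|PolarSpace vP - x| <= e / 2.
  rewrite distrC; apply: polar_norm_le => phi Qphi; exact: close.
rewrite (le_lt_trans (ler_distD x _ _))// [ltRHS]splitr.
exact: ler_ltD.
Qed.

HB.instance Definition _ :=
  Uniform_isComplete.Build polar_space polar_space_complete.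

Lemma polar_val_linear : linear (polar_val : polar_space -> E).
Proof. by []. Qed.

HB.instance Definition _ := GRing.isLinear.Build R polar_space E *:%R
  (polar_val : polar_space -> E) polar_val_linear.

End PolarSpace.

(** * Domination on one side *)

(** Removes the slack [eta] that makes two possibly zero factors positive, so that one can divide by
    them. *)
Lemma ler_mul_addgt0P (R : realType) (x C w l : R) : 0 < C -> 0 <= w -> 0 <= l ->
  (forall eta, 0 < eta -> x <= C * ((w + eta) * (l + eta))) -> x <= C * (w * l).
Proof.
move=> C0 w0 l0 xle; apply/ler_addgt0Pr => e e0.
(* For [eta <= 1] the slack costs at most [eta * D]. *)
pose D := C * (w + l + 1).
have D0 : 0 < D by rewrite mulr_gt0// ltr_wpDl// addr_ge0.
pose eta := Num.min 1 (e / D).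
have eta0 : 0 < eta by rewrite lt_min ltr01 divr_gt0.
have eta1 : eta <= 1 by rewrite ge_min lexx.
rewrite (le_trans (xle _ eta0))//.
have -> : (w + eta) * (l + eta) = w * l + eta * (w + l + eta).
  by rewrite mulrDl !mulrDr -!addrA [eta * w]mulrC [w * eta + _]addrCA.
rewrite mulrDr lerD2l mulrCA (@le_trans _ _ (eta * D))//.
  by rewrite ler_pM2l// /D ler_pM2l// lerD2l.
by rewrite -ler_pdivlMr// ge_min lexx orbT.
Qed.

(** * The mean over a dual unit ball *)

Section MeanDomination.
Context {R : realType} {M N : normedModType R}.
Variables (B : {bilinear M -> N -> R | *%R & *%R}) (s C : R).
Hypotheses (s1 : 1 <= s) (C0 : 0 < C).
(* [A m a] reads: the family [m] has Young cost at most [a], that is,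
   [lp_weak p m `^ p / p <= a]. It is kept abstract because at p = +oo the cost
   is 0 under the constraint [lp_weak +oo m <= 1]. *)
Variable A : forall n, ('I_n -> M) -> R -> Prop.
Hypothesis A0 : forall m : 'I_0 -> M, A m 0.
Hypothesis AD : forall n1 n2 (m1 : 'I_n1 -> M) (m2 : 'I_n2 -> M) a1 a2,
  A m1 a1 -> A m2 a2 -> A (fcat m1 m2) (a1 + a2).
Hypothesis AZ : forall n (m : 'I_n -> M) a t, 0 < t ->
  A m a -> A (fun i => t `^ (1 - s^-1) *: m i) (t * a).
Hypothesis AB : forall n (m : 'I_n -> M) (e : 'I_n -> N) a, A m a ->
  \sum_i B (m i) (e i) <= C * (a + lp_weak s%:E e `^ s / s).

Let K := {k : dual N | `|k| <= 1}.
Let se1 : (1 <= s%:E)%E. Proof. by rewrite lee_fin. Qed.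

Let s0 : 0 < s. Proof. exact: lt_le_trans s1. Qed.

Let pow_bounded (e : N) :
  (fun k : K => `|sval k e| `^ s) \in @bounded_pred R K.
Proof.
apply/bounded_predP; exists (`|e| `^ s) => -[k k1] /=.
rewrite ger0_norm ?powR_ge0//; apply: ge0_ler_powR; rewrite ?nnegrE ?(ltW s0)//.
by rewrite (le_trans (ler_dual_apply _ _))// ler_piMl.
Qed.

Let pow (e : N) : bounded_map := BoundedMap (pow_bounded e).

Let cst_bounded (c : R) : (fun _ : K => c) \in @bounded_pred R K.
Proof. by apply/bounded_predP; exists `|c|. Qed.

Let const (c : R) : bounded_map := BoundedMap (cst_bounded c).

(** The defect in the bound [AB] when the weak norm, a supremum over [K], is replaced by the value
    at one point. It may be negative at some points; the mean will be chosen nonnegative on all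
    gaps. *)
Let gap n (m : 'I_n -> M) (e : 'I_n -> N) a : bounded_map :=
  (C / s) *: (\sum_i pow (e i)) + const (C * a - \sum_i B (m i) (e i)).

Let sum_powE n (e : 'I_n -> N) (k : K) :
  (\sum_i pow (e i) : bounded_map) k = \sum_i `|sval k (e i)| `^ s.
Proof.
pose ev (f : @bounded_map R K) := f k.
have ev0 : ev 0 = 0 by [].
have evD : {morph ev : u w / u + w >-> u + w} by [].
by rewrite -[LHS]/(ev _) (big_morph ev evD ev0).
Qed.

Let gapE n (m : 'I_n -> M) (e : 'I_n -> N) a k : gap m e a k =
  C / s * (\sum_i `|sval k (e i)| `^ s) + (C * a - \sum_i B (m i) (e i)).
Proof. by rewrite -sum_powE. Qed.

Let gapD n1 n2 (m1 : 'I_n1 -> M) (m2 : 'I_n2 -> M) (e1 : 'I_n1 -> N)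
    (e2 : 'I_n2 -> N) a1 a2 k :
  gap (fcat m1 m2) (fcat e1 e2) (a1 + a2) k = gap m1 e1 a1 k + gap m2 e2 a2 k.
Proof.
rewrite !gapE (sum_fcat (fun m e => B m e)).
rewrite (sum_fcat (fun _ e => `|sval k e| `^ s) (fun=> tt) (fun=> tt)).
by ring.
Qed.

(** The exponents [1 - s^-1] and [s^-1] add up to 1 in the pairing, and the [s]-th power of
    [t ^ s^-1] is [t], so all three terms scale by [t]. *)
Let gapZ n (m : 'I_n -> M) (e : 'I_n -> N) a t k : 0 < t ->
  gap (fun i => t `^ (1 - s^-1) *: m i) (fun i => t `^ s^-1 *: e i) (t * a) k =
  t * gap m e a k.
Proof.
move=> t0; rewrite !gapE mulrDr mulrBr; congr (_ + (_ - _)).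
- rewrite [RHS]mulrCA; congr (_ * _); rewrite mulr_sumr; apply: eq_bigr => i _.
  rewrite linearZ normrM powRM// ger0_norm ?powR_ge0//.
  by rewrite -powRrM mulVf ?gt_eqF// powRr1// ltW.
- by rewrite mulrCA.
- rewrite mulr_sumr; apply: eq_bigr => i _.
  rewrite linearZl_LR linearZr_LR mulrA -powRD ?subrK ?powRr1 ?(ltW t0)//.
  by rewrite (gt_eqF t0) implybT.
Qed.

(** A gap at most [- eps] at every [k] would bound all power sums, hence the [s]-th power of the
    weak norm, by [Z]; then [AB] would fail by [eps]. *)
Let gap_ge n (m : 'I_n -> M) (e : 'I_n -> N) a eps : A m a -> 0 < eps ->
  exists k, - eps < gap m e a k.
Proof.
move=> Ama eps0; apply/not_existsP => H.
have {}H (k : K) : \sum_i `|sval k (e i)| `^ s <=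
    s / C * (\sum_i B (m i) (e i) - C * a - eps).
  have /negP := H k; rewrite -leNgt gapE -[s / C]invf_div ler_pdivlMl ?divr_gt0//.
  by lra.
set Z := s / C * _ in H.
have Z0 : 0 <= Z.
  have k0 : K by exists 0; rewrite normr0.
  by rewrite (le_trans _ (H k0))// sumr_ge0// => i _; exact: powR_ge0.
have wZ : lp_weak s%:E e `^ s <= Z.
  rewrite -[leRHS]powRr1// -(mulVf (lt0r_neq0 s0)) powRrM.
  apply: ge0_ler_powR; rewrite ?nnegrE ?(ltW s0) ?powR_ge0 ?(lp_weak_ge0 se1)//.
  apply: lp_weak_le => // phi phi1.
  apply: ge0_ler_powR; rewrite ?nnegrE ?invr_ge0 ?(ltW s0)// ?sumr_ge0//.
  exact: (H (exist _ phi phi1)).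
have := AB e Ama; rewrite leNgt => /negP; apply.
have -> : \sum_i B (m i) (e i) = C * (a + Z / s) + eps.
  by rewrite /Z; field; rewrite !gt_eqF.
rewrite (@le_lt_trans _ _ (C * (a + Z / s))) ?ltrDl//.
by rewrite ler_pM2l// lerD2l ler_pM2r// invr_gt0.
Qed.

(* [psi e] is the mean of [k |-> `|k e| `^ s] over the unit ball of N^*. *)
Lemma mean_domination : exists psi : N -> R,
  [/\ forall e, 0 <= psi e, forall t e, psi (t *: e) = `|t| `^ s * psi e,
      forall n (e : 'I_n -> N), \sum_i psi (e i) <= lp_weak s%:E e `^ s &
      forall n (m : 'I_n -> M) (e : 'I_n -> N) a, A m a ->
        \sum_i B (m i) (e i) <= C * (a + (\sum_i psi (e i)) / s)].
Proof.
pose H : set (@bounded_map R K) := [set h | exists n (m : 'I_n -> M) (e : 'I_n -> N) a,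
  A m a /\ forall k, h k = gap m e a k].
have k0 : K by exists 0; rewrite normr0.
have := @mean_nonneg_on_cone R K k0 H (@gap 0 (fun=> 0) (fun=> 0) 0).
case=> [|h1 h2|t h|h eps|nu [lnu nule nuH]].
- by exists 0, (fun=> 0), (fun=> 0), 0.
- move=> [n1 [m1 [e1 [a1 [A1 h1E]]]]] [n2 [m2 [e2 [a2 [A2 h2E]]]]].
  exists (gap (fcat m1 m2) (fcat e1 e2) (a1 + a2)) => [|k].
    exists (n1 + n2)%N, (fcat m1 m2), (fcat e1 e2), (a1 + a2).
    by split; first exact: AD.
  by rewrite gapD h1E h2E.
- move=> t0 [n [m [e [a [Ama hE]]]]].
  exists (gap (fun i => t `^ (1 - s^-1) *: m i) (fun i => t `^ s^-1 *: e i) (t * a)).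
    exists n, (fun i => t `^ (1 - s^-1) *: m i), (fun i => t `^ s^-1 *: e i), (t * a).
    by split; first exact: AZ.
  by move=> k; rewrite gapZ// hE.
- move=> [n [m [e [a [Ama hE]]]]] eps0.
  by have [k] := gap_ge e Ama eps0; exists k; rewrite hE.
pose nuL : {scalar bounded_map} :=
  HB.pack nu (GRing.isLinear.Build R (@bounded_map R K) R *%R nu lnu).
exists (fun e => nuL (pow e)); split=> [e|t e|n e|n m e a Ama].
- rewrite -oppr_le0 -linearN; apply: nule => k.
  by rewrite oppr_le0 powR_ge0.
- have -> : pow (t *: e) = `|t| `^ s *: pow e; last by rewrite linearZ.
  by apply: val_inj; apply/funext => k /=; rewrite linearZ normrM powRM.
- rewrite -linear_sum; apply: nule => k; rewrite sum_powE.
  rewrite -lp_norm_powR ?gt_eqF//; apply: ge0_ler_powR.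
  + exact: ltW.
  + exact: lp_norm_ge0.
  + exact: (lp_weak_ge0 se1).
  + exact: (lp_weak_ge se1 e (svalP k)).
- have gap0 : 0 <= nuL (gap m e a) by apply: nuH; exists n, m, e, a.
  have gapE' : nuL (gap m e a) =
      C / s * (\sum_i nuL (pow (e i))) + nuL (const (C * a - \sum_i B (m i) (e i))).
    by rewrite -linear_sum -linearZ -linearD.
  (* The mean of a constant is at most that constant, so nonnegativity of the mean of the gap yields
     the desired bound. *)
  have cstle : nuL (const (C * a - \sum_i B (m i) (e i))) <=
    C * a - \sum_i B (m i) (e i) by exact: nule.
  rewrite gapE' in gap0; have := le_trans gap0 (lerD (lexx _) cstle).
  rewrite mulrDr addrA subr_ge0 addrC [C * (_ / s)]mulrCA [C / s * _]mulrC.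
  by [].
Qed.

End MeanDomination.

(** * From the mean to a homogeneous dominating function *)

Section Domination.
Context {R : realType} {M N : normedModType R}.
Variables (B : {bilinear M -> N -> R | *%R & *%R}) (D : set M) (C : R).
Hypotheses (DZ : forall t m, D m -> D (t *: m)) (C0 : 0 < C).

(** The third clause will make the inclusion of [polar_space] in [E] Cohen strongly summing; the
    fourth will make the other factor strictly Lipschitz summing. *)
Definition dominating (p q : \bar R) (g : N -> R) : Prop :=
  [/\ forall e, 0 <= g e, forall t e, g (t *: e) = `|t| * g e,
      forall n (e : 'I_n -> N), lp_norm q (g \o e) <= lp_weak q e &
      forall n (m : 'I_n -> M) (e : 'I_n -> N), (forall i, D (m i)) ->
        `|\sum_i B (m i) (e i)| <= C * (lp_weak p m * lp_norm q (g \o e))].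

(** Families scaled by [W^-1] and [L^-1] have Young bound at most [1 - s^-1 + s^-1 = 1]; undoing the
    scaling turns the additive bound into a product. *)
Lemma dominating_of_mean (p : \bar R) (s : R) (psi : N -> R) :
  (1 <= p)%E -> 1 <= s ->
  (forall e, 0 <= psi e) -> (forall t e, psi (t *: e) = `|t| `^ s * psi e) ->
  (forall n (e : 'I_n -> N), \sum_i psi (e i) <= lp_weak s%:E e `^ s) ->
  (forall n (m : 'I_n -> M) (e : 'I_n -> N), (forall i, D (m i)) ->
    lp_weak p m <= 1 ->
    \sum_i B (m i) (e i) <= C * (1 - s^-1 + (\sum_i psi (e i)) / s)) ->
  dominating p s%:E (fun e => psi e `^ s^-1).
Proof.
move=> p1 s1 psi0 psiZ psi_le Bpsi; have s0 : 0 < s by rewrite (lt_le_trans _ s1).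
have sN0 : s != 0 by rewrite gt_eqF.
have se1 : (1 <= s%:E)%E by rewrite lee_fin.
have normE n (e : 'I_n -> N) :
    lp_norm s%:E ((fun e => psi e `^ s^-1) \o e) = (\sum_i psi (e i)) `^ s^-1.
  congr (_ `^ _); apply: eq_bigr => i _ /=.
  by rewrite ger0_norm ?powR_ge0// -powRrM mulVf// powRr1.
split=> [e|t e|n e|n m e Dm].
- exact: powR_ge0.
- by rewrite psiZ powRM ?powR_ge0// -powRrM mulfV// powRr1.
- rewrite normE -[leRHS]powRr1 ?(lp_weak_ge0 se1)// -(mulfV sN0) powRrM.
  apply: ge0_ler_powR; rewrite ?nnegrE ?invr_ge0 ?(ltW s0)//.
  + exact: sumr_ge0.
  + exact: powR_ge0.
have Ble (f : 'I_n -> N) (W L : R) : 0 < W -> 0 < L -> lp_weak p m <= W ->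
    \sum_i psi (f i) <= L `^ s -> \sum_i B (m i) (f i) <= C * (W * L).
  move=> W0 L0 mW fL; have WL0 : 0 < W * L by rewrite mulr_gt0.
  have := Bpsi n (fun i => W^-1 *: m i) (fun i => L^-1 *: f i)
    (fun i => DZ _ (Dm i)).
  have -> : \sum_i B (W^-1 *: m i) (L^-1 *: f i) =
      (W * L)^-1 * \sum_i B (m i) (f i).
    rewrite mulr_sumr; apply: eq_bigr => i _.
    by rewrite linearZl_LR linearZr_LR mulrA invfM.
  have -> : \sum_i psi (L^-1 *: f i) = (L `^ s)^-1 * \sum_i psi (f i).
    rewrite mulr_sumr; apply: eq_bigr => i _.
    by rewrite psiZ ger0_norm ?invr_ge0 ?(ltW L0)// powRV// ltW.
  have W1 : lp_weak p (fun i => W^-1 *: m i) <= 1.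
    rewrite (le_trans (lp_weakZ p1 _ _))// ger0_norm ?invr_ge0 ?(ltW W0)//.
    by rewrite ler_pdivrMl// mulr1.
  move=> /(_ W1); rewrite ler_pdivrMl// => /le_trans; apply.
  rewrite mulrCA ler_pM2l// ler_piMr ?(ltW WL0)//.
  rewrite -lerBrDl opprB addrC subrK ler_pdivrMr// mulVf//.
  by rewrite ler_pdivrMl ?powR_gt0// mulr1.
apply: ler_mul_addgt0P => // [||eta eta0].
- exact: lp_weak_ge0.
- exact: lp_norm_ge0.
have W0 : 0 < lp_weak p m + eta by rewrite ltr_wpDl ?lp_weak_ge0.
set L := lp_norm _ _ + eta; have L0 : 0 < L by rewrite ltr_wpDl ?lp_norm_ge0.
have mW : lp_weak p m <= lp_weak p m + eta by rewrite lerDl ltW.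
have eL : \sum_i psi (e i) <= L `^ s.
  rewrite -[leLHS]powRr1 ?sumr_ge0// -(mulVf sN0) powRrM -normE.
  apply: ge0_ler_powR; rewrite ?nnegrE ?(ltW s0) ?(ltW L0) ?lp_norm_ge0//.
  by rewrite lerDl ltW.
rewrite ler_norml (Ble e)// andbT lerNl -sumrN.
have -> : \sum_i - B (m i) (e i) = \sum_i B (m i) (- e i).
  by apply: eq_bigr => i _; rewrite linearNr.
apply: Ble => //; rewrite (le_trans _ eL)// le_eqVlt; apply/orP; left; apply/eqP.
by apply: eq_bigr => i _; rewrite -scaleN1r psiZ normrN1 powR1 mul1r.
Qed.

Theorem exists_dominating (p : \bar R) : (1 <= p)%E ->
  (forall n (m : 'I_n -> M) (e : 'I_n -> N), (forall i, D (m i)) ->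
    `|\sum_i B (m i) (e i)| <= C * (lp_weak p m * lp_weak (hoelder_conjugate p) e)) ->
  exists g, dominating p (hoelder_conjugate p) g.
Proof.
move=> p1 HB; have q1 := hoelder_conj_ge1 p1.
have [[pE qE]|[pE qE]|[r [s [r1 s1 rs pE qE]]]] := hoelder_conjugate_cases p1;
  rewrite {}qE in HB q1 *.
(* For [q = +oo] the weak norm of [e] is the largest of the norms, by norming functionals. *)
- exists (fun e => `|e|); split=> // [t e|n e|n m e Dm].
  + exact: normrZ.
  + apply: bigmax_le => [|i _]; first exact: lp_weak_ge0.
    rewrite /= normr_id; have [phi phi1 phie] := norming_functional (e i).
    rewrite -[leLHS]normr_id -phie (le_trans _ (lp_weak_ge q1 e phi1))//.
    exact: (lp_normy_ge (fun i => phi (e i))).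
  + rewrite (le_trans (HB _ _ _ Dm))// ler_pM2l// ler_wpM2l ?lp_weak_ge0//.
    apply: lp_weak_le => // phi phi1; apply: le_lp_norm => // i /=.
    by rewrite normr_id (le_trans (ler_dual_apply _ _))// ler_piMl.
- have py : (1 <= +oo :> \bar R)%E by exact: leey.
  (* With [s = 1] the scaling factor [t ^ (1 - s^-1)] is 1, so the constraint on the weak norm
     survives rescaling; it survives concatenation because it bounds each coordinate separately. *)
  pose A n (m : 'I_n -> M) (a : R) :=
    [/\ forall i, D (m i), 0 <= a & lp_weak +oo m <= 1].
  have [||||psi [psi0 psiZ psi_le Bpsi]] := @mean_domination R M N B 1 C (lexx 1) C0 A.
  + move=> m; split=> [[]||] //; apply: lp_weak_le => // phi phi1.
    by rewrite /lp_norm big_ord0.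
  + move=> n1 n2 m1 m2 a1 a2 [D1 a10 m11] [D2 a20 m21].
    split; [exact: forall_fcat|exact: addr_ge0|].
    apply: lp_weak_le => // phi phi1; apply: bigmax_le => // i _.
    apply: (forall_fcat (P := fun u => `|phi u| <= 1)) => j.
      rewrite (le_trans _ m11)// (le_trans _ (lp_weak_ge _ m1 phi1))//.
      exact: (lp_normy_ge (fun i => phi (m1 i))).
    rewrite (le_trans _ m21)// (le_trans _ (lp_weak_ge _ m2 phi1))//.
    exact: (lp_normy_ge (fun i => phi (m2 i))).
  + move=> n m a t t0 [Dm a0 m1]; rewrite invr1 subrr powRr0.
    split=> [i||]; [exact: DZ|by rewrite mulr_ge0// ltW|].
    by rewrite (le_trans (lp_weakZ _ _ _))// normr1 mul1r.
  + move=> n m e a [Dm a0 m1]; rewrite divr1 powRr1 ?lp_weak_ge0//.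
    rewrite (le_trans (ler_norm _))// (le_trans (HB _ _ _ Dm))// ler_pM2l// pE.
    rewrite (@le_trans _ _ (1 * lp_weak 1 e))//.
      by rewrite ler_wpM2r// lp_weak_ge0.
    by rewrite mul1r lerDr.
  exists (fun e => psi e `^ 1^-1); apply: dominating_of_mean => // n m e Dm m1.
  by apply: Bpsi; split=> //; rewrite -?pE// invr1 subrr.
- have r0 : 0 < r by rewrite (lt_trans _ r1).
  have rN0 : r != 0 by rewrite gt_eqF.
  have rE : 1 - s^-1 = r^-1 by rewrite -rs addrK.
  have p1' : (1 <= r%:E)%E by rewrite -pE.
  have wr0 n (m : 'I_n -> M) : 0 <= lp_weak r%:E m by exact: lp_weak_ge0.
  (* The cost is subadditive along concatenation because for each functional the power sums add;
     scaling by [t ^ r^-1] multiplies it by at most [t]. *)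
  pose A n (m : 'I_n -> M) (a : R) :=
    (forall i, D (m i)) /\ lp_weak r%:E m `^ r / r <= a.
  have powle (x y : R) : 0 <= x -> x <= y -> x `^ r <= y `^ r.
    move=> x0 xy; apply: ge0_ler_powR => //; first exact: ltW.
    by rewrite nnegrE (le_trans x0).
  have [||||psi [psi0 psiZ psi_le Bpsi]] := @mean_domination R M N B s C q1 C0 A.
  + move=> m; split=> [[]|] //.
    have -> : lp_weak r%:E m = 0.
      apply/eqP; rewrite eq_le wr0 andbT; apply: lp_weak_le => // phi phi1.
      by rewrite /lp_norm big_ord0 powR0// invr_neq0.
    by rewrite powR0// mul0r.
  + move=> n1 n2 m1 m2 a1 a2 [D1 h1] [D2 h2]; split; first exact: forall_fcat.
    rewrite (le_trans _ (lerD h1 h2))// -mulrDl ler_pM2r ?invr_gt0//.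
    have sum0 : 0 <= lp_weak r%:E m1 `^ r + lp_weak r%:E m2 `^ r.
      by rewrite addr_ge0 ?powR_ge0.
    rewrite -[leRHS]powRr1// -(mulVf rN0) powRrM; apply: (powle) => //.
    apply: lp_weak_le => // phi phi1.
    apply: ge0_ler_powR; rewrite ?nnegrE ?invr_ge0 ?(ltW r0)//.
      by rewrite sumr_ge0// => i _; exact: powR_ge0.
    rewrite (sum_fcat (fun u _ => `|phi u| `^ r) m1 m2 (fun=> tt) (fun=> tt)).
    by rewrite -!lp_norm_powR// lerD// powle ?lp_norm_ge0 ?lp_weak_ge.
  + move=> n m a t t0 [Dm ma]; split=> [i|]; first exact: DZ.
    rewrite rE ler_pdivrMr// -mulrA -ler_pdivrMl// -ler_pdivrMr// (le_trans _ ma)//.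
    rewrite ler_pM2r ?invr_gt0// ler_pdivrMl//.
    rewrite (le_trans (powle _ _ (wr0 _ _) (lp_weakZ p1' _ _)))//.
    rewrite powRM// ger0_norm ?powR_ge0//.
    by rewrite -powRrM mulVf// powRr1// ltW.
  + move=> n m e a [Dm ma].
    rewrite (le_trans (ler_norm _))// (le_trans (HB _ _ _ Dm))// ler_pM2l// pE.
    rewrite (le_trans (conjugate_powR _ _ r0 _ rs)) ?(lp_weak_ge0 q1)//.
      by rewrite (lt_trans _ s1).
    by rewrite lerD2r.
  exists (fun e => psi e `^ s^-1); apply: dominating_of_mean => // n m e Dm m1.
  (* On families of weak norm at most 1 the cost is at most [r^-1 = 1 - s^-1]. *)
  rewrite pE in m1; apply: Bpsi; split=> //; rewrite rE ler_pdivrMr// mulVf//.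
  by rewrite (le_trans (powle _ _ (wr0 _ _) m1))// powR1.
Qed.

End Domination.

(** * Factorization *)

Lemma dual_precomp (R : realType) (G E : normedModType R) (S : {linear G -> E})
    (phi : dual E) : continuous S ->
  exists psi : dual G, forall v, psi v = phi (S v).
Proof.
move=> cS; have cP : (fun v => phi (S v)) \in dual_pred (V := G).
  apply/dual_predP; split=> [a u v|v]; first by rewrite !linearP.
  by apply: continuous_comp; [exact: cS|exact: dual_continuous].
by exists (Dual cP).
Qed.

Lemma ler_norm_ldelta (R : realType) (X : metricType R) (x0 x y : X) :
  `|ldelta x0 x y| <= mdist x y.
Proof.
apply: dual_norm_le => f f1; rewrite (le_trans (ler_lip_norm f x y))//.
by rewrite ler_piMl ?mdist_ge0.
Qed.

Lemma lip_pair_precomp (R : realType) (X : metricType R) (x0 : X)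
    (G E : normedModType R) (U : Lip0 x0 G) (T : Lip0 x0 E)
    (phi : dual E) (psi : dual G) : (forall x, psi (U x) = phi (T x)) ->
  forall m, lip_pair U m psi = lip_pair T m phi.
Proof.
move=> UT m; congr (lipfree_val m _); apply: val_inj.
by apply/funext => x; exact: UT.
Qed.

Section Factorization.
Context {R : realType} {X : metricType R} {x0 : X} {E : completeNormedModType R}.
Variables (T : Lip0 x0 E) (p : \bar R) (C : R) (g : dual E -> R).
Hypotheses (p1 : (1 <= p)%E) (C0 : 0 < C).

Let q := hoelder_conjugate p.
Let q1 : (1 <= q)%E. Proof. exact: hoelder_conj_ge1. Qed.

Hypothesis gdom : dominating
  (lip_pair T : {bilinear lipfree x0 -> dual E -> R | *%R & *%R})
  (fun m => delta_span m) C p q g.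

Let Q : set (dual E) := [set phi | g phi <= 1].

(** On a single functional the third clause of [dominating] bounds [g phi] by the norm of [phi], so
    the dual unit ball lies in [Q]. *)
Let g_le1 phi : Q phi \/ `|phi| <= 1 -> g phi <= 1.
Proof.
case: gdom => g0 _ gw _ [//|phi1].
have := gw 1%N (fun=> phi); have := lp_weak_le_sum q1 (fun _ : 'I_1 => phi).
rewrite big_ord1 => h1 h2; rewrite (le_trans _ (le_trans h2 (le_trans h1 phi1)))//.
have := @lp_norm_coord _ q 1 (g \o fun=> phi) ord0 q1.
by rewrite /= ger0_norm.
Qed.

(** The dominated bound for one delta, whose norm is at most the distance. It places [T x] in the
    polar space and makes [T] Lipschitz with constant [C] there. *)
Let pair_le phi x y : Q phi \/ `|phi| <= 1 ->
  `|phi (T x - T y)| <= C * mdist x y.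
Proof.
move=> Qphi; case: gdom => g0 _ _ Bg.
have := Bg 1%N (fun=> ldelta x0 x y) (fun=> phi).
rewrite big_ord1 /= lip_pair_delta => /(_ _)/le_trans; apply.
  move=> _; exists 1%N, (fun=> 1), (fun=> x), (fun=> y).
  by rewrite big_ord1 scale1r.
rewrite ler_pM2l// -[leRHS]mulr1; apply: ler_pM.
- exact: lp_weak_ge0.
- exact: lp_norm_ge0.
- rewrite (le_trans (lp_weak_le_sum _ _))// big_ord1.
  exact: ler_norm_ldelta.
- rewrite (le_trans (lp_norm_le_sum _ _))// big_ord1/= ger0_norm//.
  exact: g_le1.
Qed.

Let T_polar x : T x \in polar_pred Q.
Proof.
apply/polar_predP; exists (C * mdist x x0) => phi Qphi.
by have := pair_le x x0 (or_introl Qphi); rewrite lip0_base subr0.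
Qed.

Let U_lip : (fun x => PolarSpace (T_polar x)) \in lip0_pred x0 (V := polar_space Q).
Proof.
apply/lip0_predP; split; first by apply: val_inj; exact: lip0_base.
by exists C => x y; apply: polar_norm_le => phi Qphi; exact: pair_le.
Qed.

Let U : Lip0 x0 (polar_space Q) := MkLip0 U_lip.
Let S : {linear polar_space Q -> E} := @polar_val _ _ Q.

Let S_continuous : continuous S.
Proof.
apply: bounded_linear_continuous; apply/linear_boundedP; exists 1; split=> //.
move=> r r1 v; apply: (le_trans (norm_le_polar_norm v)).
exact: ler_peMl (normr_ge0 v) (ltW r1).
Qed.

Let polar_apply (v : polar_space Q) (phi : dual E) : `|phi (S v)| <= `|v| * g phi.
Proof.
case: gdom => g0 gZ _ _; apply/ler_addgt0Pr => e e0.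
have v1 : 0 < `|v| + 1 by rewrite ltr_wpDl.
(* [d] is positive even when [g phi = 0], and its excess over [g phi] costs at most [e]. *)
pose d := g phi + e / (`|v| + 1).
have d0 : 0 < d by rewrite ltr_wpDl// divr_gt0.
have Qd : Q (d^-1 *: phi).
  rewrite /Q/= gZ ger0_norm ?invr_ge0 ?(ltW d0)// ler_pdivrMl// mulr1.
  by rewrite lerDl divr_ge0// ltW.
have := polar_norm_ge v (or_introl Qd).
rewrite [X in `|X|](_ : _ = d^-1 * phi (S v))// normrM ger0_norm ?invr_ge0 ?(ltW d0)//.
rewrite ler_pdivrMl// => /le_trans; apply; rewrite mulrC mulrDr lerD2l.
by rewrite mulrCA ler_piMr ?(ltW e0)// ler_pdivrMr// mul1r lerDl.
Qed.

Let S_cohen : cohen_strongly_summing p S.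
Proof.
case: gdom => g0 _ gw _; exists 1 => // n x y; rewrite mul1r.
rewrite (@le_trans _ _ (\sum_i `| `|x i| | * `|(g \o y) i|))//.
  apply: ler_sum => i _; rewrite normr_id (ger0_norm (g0 _)).
  exact: polar_apply.
by rewrite (le_trans (lp_hoelder _ _ p1))// ler_wpM2l ?lp_norm_ge0.
Qed.

(** Functionals with [g <= 1] that nearly attain the polar norms of the [v i] are weighted by [w i]
    and inserted in the domination; this replaces the values of [g] by the weights. *)
Let polar_pair_le n (m : 'I_n -> lipfree x0) (v : 'I_n -> polar_space Q)
    (w : 'I_n -> R) : (forall i, delta_span (m i)) ->
  (forall i s, lip_pair U (m i) s = s (v i)) -> (forall i, 0 <= w i) ->
  \sum_i w i * `|v i| <= C * (lp_weak p m * lp_norm q w).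
Proof.
move=> Dm mv w0; case: gdom => g0 gZ _ Bg.
have vT i (phi : dual E) : phi (S (v i)) = lip_pair T (m i) phi.
  have [psi psiE] := dual_precomp phi S_continuous.
  rewrite -psiE -mv; apply: lip_pair_precomp => x.
  exact: psiE.
apply/ler_addgt0Pr => e e0.
have W0 : 0 < \sum_i w i + 1 by rewrite ltr_wpDl ?sumr_ge0.
pose d := e / (\sum_i w i + 1); have d0 : 0 < d by rewrite divr_gt0.
have /choice[phi phiP] : forall i, exists phi : dual E,
    g phi <= 1 /\ `|v i| <= `|phi (S (v i))| + d.
  move=> i; apply/not_existsP => H.
  have : `|v i| <= `|v i| - d.
    apply: polar_norm_le => phi Qphi; rewrite lerBrDr leNgt; apply/negP => h.
    by apply: (H phi); split; [exact: g_le1|exact: ltW].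
  by rewrite lerBrDr gerDl leNgt d0.
(* The sign makes each term equal to [w i] times an absolute value, while [g (th i *: phi i)] stays
   at most [w i]. *)
pose th i := Num.sg (lip_pair T (m i) (phi i)) * w i.
have := Bg n m (fun i => th i *: phi i) Dm.
have -> : \sum_i lip_pair T (m i) (th i *: phi i) = \sum_i w i * `|phi i (S (v i))|.
  apply: eq_bigr => i _; rewrite lip_pairZr vT /th mulrAC mulrC.
  by rewrite -normrEsg.
rewrite ger0_norm; last by rewrite sumr_ge0// => i _; rewrite mulr_ge0.
move=> h; rewrite (@le_trans _ _ (\sum_i w i * `|phi i (S (v i))| + e))//.
  rewrite (@le_trans _ _ (\sum_i w i * (`|phi i (S (v i))| + d)))//.
    by apply: ler_sum => i _; rewrite ler_wpM2l// (phiP i).2.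
  under eq_bigr do rewrite mulrDr.
  rewrite big_split/= lerD2l -mulr_suml mulrCA ler_piMr ?(ltW e0)//.
  by rewrite ler_pdivrMr// mul1r lerDl.
rewrite lerD2r (le_trans h)// ler_pM2l// ler_wpM2l ?lp_weak_ge0//.
apply: le_lp_norm => // i; rewrite /= gZ /th normrM normr_id normrM.
rewrite (ger0_norm (g0 _)) (le_trans (ler_piMr _ (phiP i).1)) ?mulr_ge0//.
rewrite ler_piMl// normr_sg.
by case: eqP.
Qed.

Let U_summing : strictly_lipschitz_summing p U.
Proof.
apply/(@le_inf_representsP _ _ _ _ p p1 U (fun n e => lp_strong q e)).
  by move=> n e; exact: lp_norm_ge0.
exists C => // n m e Dm.
have /choice[v vE] : forall i, exists v, forall s, lip_pair U (m i) s = s v.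
  by move=> i; exact: delta_span_vector.
rewrite (le_trans (ler_norm_sum _ _ _))//.
rewrite (le_trans _ (polar_pair_le Dm vE (fun i => normr_ge0 (e i))))//.
by apply: ler_sum => i _; rewrite vE ler_dual_apply.
Qed.

Theorem dominated_factorization :
  exists (G : completeNormedModType R) (U : Lip0 x0 G) (S : {linear G -> E}),
    [/\ strictly_lipschitz_summing p U, continuous S,
        cohen_strongly_summing p S & forall x, T x = S (U x)].
Proof. by exists (polar_space Q), U, S. Qed.

End Factorization.

Theorem theorem3p8 (R : realType) (p : \bar R) (hp : (1 <= p)%E)
    (X : metricType R) (x0 : X) (E : completeNormedModType R) (T : Lip0 x0 E) :
  strictly_lipschitz_nuclear p T <->
  exists (G : completeNormedModType R) (U : Lip0 x0 G) (S : {linear G -> E}),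
    [/\ strictly_lipschitz_summing p U,
        continuous S,
        cohen_strongly_summing p S
      & forall x, T x = S (U x)].
Proof.
have q1 := hoelder_conj_ge1 hp.
split=> [|[G [U [S [sU cS [C2 C20 cohS] TE]]]]].
  move=> /(@le_inf_representsP _ _ _ _ p hp T
    (fun n e => lp_weak (hoelder_conjugate p) e)) => -[n e|C C0 nucT].
    exact: lp_weak_ge0.
  have DZ t (m : lipfree x0) : delta_span m -> delta_span (t *: m).
    have D0 : delta_span (0 : dual (Lip0 x0 R)).
      by exists 0%N, (fun=> 0), (fun=> x0), (fun=> x0); rewrite big_ord0.
    by move=> Dm; have := delta_span_lin t Dm D0; rewrite addr0.
  have [g gdom] := exists_dominating DZ C0 hp nucT.
  exact: dominated_factorization gdom.
move: sU => /(@le_inf_representsP _ _ _ _ p hp U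
    (fun n e => lp_strong (hoelder_conjugate p) e)) => -[n e|C1 C10 sumU].
  exact: lp_norm_ge0.
apply/(@le_inf_representsP _ _ _ _ p hp T
    (fun n e => lp_weak (hoelder_conjugate p) e)).
  by move=> n e; exact: lp_weak_ge0.
exists (C2 * C1) => [|n m e Dm]; first exact: mulr_gt0.
have /choice[v vE] : forall i, exists v, forall s, lip_pair U (m i) s = s v.
  by move=> i; exact: delta_span_vector.
(* In effect [T_L (m i) = S (v i)], with [v i = U_L (m i)]. *)
have TS i : lip_pair T (m i) (e i) = e i (S (v i)).
  have [psi psiE] := dual_precomp (e i) cS.
  rewrite -psiE -vE; apply/esym; apply: lip_pair_precomp => x.
  by rewrite psiE TE.
(* Summability of [U] is tested on [w i *: phi i], with [phi i] norming [v i] and [w] the extremal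
   weights of Hölder's inequality; the strong conjugate norm of this family is at most 1. *)
have v_le : lp_strong p v <= C1 * lp_weak p m.
  have [w [w0 w1]] := lp_norm_attained (fun i => `|v i|) hp.
  rewrite -[lp_norm p _]/(lp_strong p v) => <-.
  have /choice[phi phiP] : forall i, exists phi : dual G,
      `|phi| <= 1 /\ phi (v i) = `|v i|.
    by move=> i; have [phi ? ?] := norming_functional (v i); exists phi.
  have := sumU n m (fun i => w i *: phi i) Dm.
  have -> : \sum_i lip_pair U (m i) (w i *: phi i) = \sum_i w i * `| `|v i| |.
    by apply: eq_bigr => i _; rewrite lip_pairZr vE (phiP i).2 normr_id.
  move=> /(le_trans (ler_norm _))/le_trans; apply.
  rewrite ler_pM2l// ler_piMr ?lp_weak_ge0// (le_trans _ w1)//.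
  apply: le_lp_norm => // i; rewrite normr_id normrZ ler_piMr//.
  exact: (phiP i).1.
rewrite (le_trans (ler_norm_sum _ _ _))//.
under eq_bigr do rewrite TS.
rewrite (le_trans (cohS _ _ _))// !mulrA ler_wpM2r ?lp_weak_ge0//.
by rewrite -mulrA ler_pM2l.
Qed.
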